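(* Let $n\ge 3$ be an integer and let $$X(x,y)=(x,y,\varphi_1(x,y),\ldots,\varphi_{n-2}(x,y)),\quad (x,y)\in\mathbb R^2,$$ with $\varphi_\Sigma\in C^2(\mathbb R^2,\mathbb R)$ for $\Sigma=1,\ldots,n-2$, be a minimal surface graph in $\mathbb R^n$ which is complete, that is, defined over the whole plane $\mathbb R^2$. Suppose there are real constants $\Omega\in(0,+\infty)$ and $\omega\in[0,2)$ such that $$\|X\|_{C^0(B_R)}\le\Omega R^\omega\quad\text{for all sufficiently large } R.$$ Then $X$ represents an affine plane (equivalently, each $\varphi_\Sigma$ is an affine function of $(x,y)$).
   Context: Notation: $B_R:=\{(x,y)\in\mathbb R^2: x^2+y^2<R^2\}$ and $\|X\|_{C^0(B_R)}:=\sup_{(x,y)\in B_R}|X(x,y)|$, with $|\cdot|$ the Euclidean norm in $\mathbb R^n$. A graph $X$ is a minimal surface graph if its mean curvature vector vanishes identically; equivalently, writing $u^1,u^2$ for local surface parameters, $h_{ij}:=X_{u^i}\cdot X_{u^j}$, $W:=\sqrt{h_{11}h_{22}-h_{12}^2}$, $L_{N,ij}:=X_{u^iu^j}\cdot N$, one has $$H_N:=\frac{L_{N,11}h_{22}-2L_{N,12}h_{12}+L_{N,22}h_{11}}{2W^2}\equiv 0$$ for every unit normal vector field $N$ along $X$. *)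

(* Defs.v *)
From Stdlib Require Import Reals.
From mathcomp Require Import ssreflect ssrfun ssrbool eqtype ssrnat fintype bigop.
From Coquelicot Require Import Coquelicot.

Set Implicit Arguments.
Unset Strict Implicit.
Unset Printing Implicit Defensive.

Local Open Scope R_scope.

Definition vec (n : nat) : Type := 'I_n -> R.

Definition dot (n : nat) (a b : vec n) : R :=
  \big[Rplus/0]_(i < n) (a i * b i).

Definition enorm (n : nat) (a : vec n) : R := sqrt (dot a a).

Definition is_C2 (f : R -> R -> R) : Prop := forall x y : R, ex_diff_n f 2 x y.

(* (x, y, phi_1(x,y), ..., phi_{n-2}(x,y)), with coordinates numbered from 0.
   The index k of the third case always satisfies k < n - 2, so the value 0
   is never taken. *)
Definition graph (n : nat) (phi : 'I_(n - 2) -> R -> R -> R) (x y : R) : vec n :=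
  fun i => match nat_of_ord i with
           | O => x
           | S O => y
           | S (S k) =>
               match (insub k : option 'I_(n - 2)) with
               | Some s => phi s x y
               | None => 0
               end
           end.

Section Surface.

Variables (n : nat) (X : R -> R -> vec n).

(* [pd j k x y] is the vector of the derivatives of order j in the first
   parameter and k in the second one. *)
Definition pd (j k : nat) (x y : R) : vec n :=
  fun i => partial_derive j k (fun u v => X u v i) x y.

Definition h11 (x y : R) : R := dot (pd 1 0 x y) (pd 1 0 x y).
Definition h12 (x y : R) : R := dot (pd 1 0 x y) (pd 0 1 x y).
Definition h22 (x y : R) : R := dot (pd 0 1 x y) (pd 0 1 x y).

Definition area_W (x y : R) : R := sqrt (h11 x y * h22 x y - h12 x y ^ 2).

(* No regularity of N is required: the mean curvature below depends on N only
   through its value at the point. *)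
Definition unit_normal_field (N : R -> R -> vec n) : Prop :=
  forall x y : R,
    enorm (N x y) = 1 /\
    dot (N x y) (pd 1 0 x y) = 0 /\
    dot (N x y) (pd 0 1 x y) = 0.

Definition mean_curvature (N : R -> R -> vec n) (x y : R) : R :=
  let L11 := dot (pd 2 0 x y) (N x y) in
  let L12 := dot (pd 1 1 x y) (N x y) in
  let L22 := dot (pd 0 2 x y) (N x y) in
  (L11 * h22 x y - 2 * L12 * h12 x y + L22 * h11 x y) / (2 * area_W x y ^ 2).

Definition minimal_surface : Prop :=
  forall N : R -> R -> vec n, unit_normal_field N ->
  forall x y : R, mean_curvature N x y = 0.

(* The supremum of |X| over the open disc B_r, in the extended reals. *)
Definition C0_norm_disc (r : R) : Rbar :=
  Lub_Rbar (fun t => exists x y : R, x ^ 2 + y ^ 2 < r ^ 2 /\ t = enorm (X x y)).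

(* The image of X is a two-dimensional affine subspace. *)
Definition represents_affine_plane : Prop :=
  exists P A B : vec n,
    (forall s t : R, (forall i, s * A i + t * B i = 0) -> s = 0 /\ t = 0) /\
    (forall q : vec n,
       (exists x y : R, forall i, q i = X x y i) <->
       (exists s t : R, forall i, q i = P i + s * A i + t * B i)).

End Surface.

Definition affine2 (f : R -> R -> R) : Prop :=
  exists a b c : R, forall x y : R, f x y = a * x + b * y + c.

(* Main.v *)
Require Import Defs.
From HB Require Import structures.
From Stdlib Require Import Reals Lra.
From mathcomp Require Import ssreflect ssrfun ssrbool eqtype ssrnat fintype bigop.
From Coquelicot Require Import Coquelicot.
Local Open Scope R_scope.

(** Testing minimality against the unit normals proportional to
    (-(phi_s)_x, -(phi_s)_y, e_s) gives h22 phi_xx - 2 h12 phi_xy + h11 phi_yy = 0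
    for every coordinate. Consequently the normalized metric h / W, of
    determinant 1, consists of two closed 1-forms dF and dG. The map
    T = id + (F, G) is strongly monotone, hence a bijection of the plane with
    Lipschitz inverse, and z = x + i y |-> conj (2 z - T z) is an entire
    Lipschitz function of T z, so it is affine and h / W is constant
    (Joergens' argument). After a linear change of variables each phi_s is then
    harmonic with growth o(r^2), so it is affine. Both Liouville theorems rest
    on the formula PI r a_x(0) = int_0^(2 PI) a(r cos t, r sin t) cos t dt for
    the real part a of a holomorphic function. *)

(** The growth hypothesis enters only at the last Liouville step; h / W is constant for every entire
    minimal graph. The exponent 2 is sharp: the graph of z |-> z^2 in R^4 is minimal, |X| has order
    R^2 on it, and its h / W is the identity matrix. The two 1-forms are closed because x and y are
    harmonic functions on a minimal surface: their Laplace-Beltrami equations read (h22 / W)_x =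
    (h12 / W)_y and (h11 / W)_y = (h12 / W)_x. The codimension enters only through scalar products.
    Adding the identity to (F, G) is what makes the map invertible: the gradient map of a convex
    function need not be onto, but id + (F, G) expands distances. The obstacle is regularity. With
    phi_s only of class C^2, h / W is only C^1, and the holomorphic functions that arise are known
    only as C^1 pairs whose derivatives are merely continuous. The circle formula therefore involves
    first derivatives only, and translates replace second derivatives where these are not at
    hand. *)

Lemma continuity_2d_comp (f g h : R -> R -> R) (x y : R) :
  continuity_2d_pt f (g x y) (h x y) ->
  continuity_2d_pt g x y -> continuity_2d_pt h x y ->
  continuity_2d_pt (fun u v => f (g u v) (h u v)) x y.
Proof.
move=> Hf Hg Hh eps; have [d Hd] := Hf eps.
apply: locally_2d_impl (Hg d); apply: locally_2d_impl (Hh d).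
by apply: locally_2d_forall => u v H1 H2; apply: Hd.
Qed.

Lemma continuous_of_2d (f : R -> R -> R) (g h : R -> R) (x : R) :
  continuity_2d_pt f (g x) (h x) -> continuous g x -> continuous h x ->
  continuous (fun t => f (g t) (h t)) x.
Proof.
move=> /continuity_2d_pt_filterlim Hf Hg Hh.
exact: (continuous_comp_2 g h (fun u v => f u v) x Hg Hh Hf).
Qed.

(** * Continuously differentiable functions on the plane *)

(** The partial derivatives are arguments, so that every construction carries its derivatives in
    closed form; differentiability is the total one, which the chain rule requires. *)
Definition C1 (f fx fy : R -> R -> R) : Prop := forall x y : R,
  differentiable_pt_lim f x y (fx x y) (fy x y) /\
  continuity_2d_pt fx x y /\ continuity_2d_pt fy x y.

Lemma C1_partials (f fx fy : R -> R -> R) :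
  (forall x y, is_derive (fun t => f t y) x (fx x y)) ->
  (forall x y, is_derive (fun t => f x t) y (fy x y)) ->
  (forall x y, continuity_2d_pt fx x y) ->
  (forall x y, continuity_2d_pt fy x y) -> C1 f fx fy.
Proof.
move=> Hx Hy Cx Cy x y; split; last by split.
apply/filterdiff_differentiable_pt_lim.
apply: (is_derive_filterdiff f x y fx (fy x y)).
- exact: filter_forall.
- exact: Hy.
- by apply/continuity_2d_pt_filterlim; exact: Cx.
Qed.

Lemma C1_cont (f fx fy : R -> R -> R) (x y : R) :
  C1 f fx fy -> continuity_2d_pt f x y.
Proof.
move=> H; apply: differentiable_continuity_pt.
by exists (fx x y), (fy x y); case: (H x y).
Qed.

Lemma C1_curve (f fx fy : R -> R -> R) (g h : R -> R) (t lg lh : R) :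
  C1 f fx fy -> is_derive g t lg -> is_derive h t lh ->
  is_derive (fun s => f (g s) (h s)) t
    (fx (g t) (h t) * lg + fy (g t) (h t) * lh).
Proof.
move=> H /is_derive_Reals Hg /is_derive_Reals Hh; apply/is_derive_Reals.
apply: (derivable_pt_lim_comp_2d f g h) => //.
by case: (H (g t) (h t)).
Qed.

Lemma C1_dx (f fx fy : R -> R -> R) (x y : R) :
  C1 f fx fy -> is_derive (fun t => f t y) x (fx x y).
Proof.
move=> H.
have := C1_curve f fx fy (fun t => t) (fun=> y) x 1 0 H
  (is_derive_id x) (is_derive_const y x).
by rewrite Rmult_1_r Rmult_0_r Rplus_0_r.
Qed.

Lemma C1_dy (f fx fy : R -> R -> R) (x y : R) :
  C1 f fx fy -> is_derive (fun t => f x t) y (fy x y).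
Proof.
move=> H.
have := C1_curve f fx fy (fun=> x) (fun t => t) y 0 1 H
  (is_derive_const x y) (is_derive_id y).
by rewrite Rmult_1_r Rmult_0_r Rplus_0_l.
Qed.

Lemma C1_ext (f g fx fy gx gy : R -> R -> R) :
  (forall x y, f x y = g x y) -> (forall x y, fx x y = gx x y) ->
  (forall x y, fy x y = gy x y) -> C1 f fx fy -> C1 g gx gy.
Proof.
move=> H0 H1 H2 H x y; have [Hd [Cx Cy]] := H x y; split; [|split].
- rewrite -H1 -H2; apply: differentiable_pt_lim_ext Hd.
  by apply: locally_2d_forall.
- exact: continuity_2d_pt_ext Cx.
- exact: continuity_2d_pt_ext Cy.
Qed.

Ltac cont2 := repeat first
  [ assumption
  | apply: continuity_2d_pt_const | apply: continuity_2d_pt_id1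
  | apply: continuity_2d_pt_id2 | apply: continuity_2d_pt_plus
  | apply: continuity_2d_pt_minus | apply: continuity_2d_pt_mult
  | apply: continuity_2d_pt_opp ].

Lemma C1_const (c : R) : C1 (fun _ _ => c) (fun _ _ => 0) (fun _ _ => 0).
Proof.
by apply: C1_partials => x y; try exact: is_derive_const; cont2.
Qed.

Lemma C1_comp (f fx fy g gx gy h hx hy : R -> R -> R) :
  C1 f fx fy -> C1 g gx gy -> C1 h hx hy ->
  C1 (fun x y => f (g x y) (h x y))
     (fun x y => fx (g x y) (h x y) * gx x y + fy (g x y) (h x y) * hx x y)
     (fun x y => fx (g x y) (h x y) * gy x y + fy (g x y) (h x y) * hy x y).
Proof.
move=> Hf Hg Hh x y.
have Cg := C1_cont g gx gy x y Hg; have Ch := C1_cont h hx hy x y Hh.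
have [Df [Cfx Cfy]] := Hf (g x y) (h x y).
have [Dg [Cgx Cgy]] := Hg x y; have [Dh [Chx Chy]] := Hh x y.
split; first exact: differentiable_pt_lim_comp.
have C1' := continuity_2d_comp fx g h x y Cfx Cg Ch.
have C2' := continuity_2d_comp fy g h x y Cfy Cg Ch.
by split; cont2.
Qed.

Lemma C1_plus (f fx fy g gx gy : R -> R -> R) :
  C1 f fx fy -> C1 g gx gy ->
  C1 (fun x y => f x y + g x y)
     (fun x y => fx x y + gx x y) (fun x y => fy x y + gy x y).
Proof.
move=> Hf Hg.
have HP : C1 (fun x y => x + y) (fun _ _ => 1) (fun _ _ => 1).
  apply: C1_partials => x y; try cont2; auto_derive => //; ring.
apply: C1_ext (C1_comp _ _ _ _ _ _ _ _ _ HP Hf Hg) => x y //=; ring.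
Qed.

Lemma C1_mult (f fx fy g gx gy : R -> R -> R) :
  C1 f fx fy -> C1 g gx gy ->
  C1 (fun x y => f x y * g x y)
     (fun x y => fx x y * g x y + f x y * gx x y)
     (fun x y => fy x y * g x y + f x y * gy x y).
Proof.
move=> Hf Hg.
have HP : C1 (fun x y => x * y) (fun _ y => y) (fun x _ => x).
  apply: C1_partials => x y; try cont2; auto_derive => //; ring.
apply: C1_ext (C1_comp _ _ _ _ _ _ _ _ _ HP Hf Hg) => x y //=; ring.
Qed.

Lemma C1_linear (a b c : R) :
  C1 (fun x y => a * x + b * y + c) (fun _ _ => a) (fun _ _ => b).
Proof.
apply: C1_partials => x y; try cont2; auto_derive => //; ring.
Qed.

Lemma C1_scal (k : R) (f fx fy : R -> R -> R) :
  C1 f fx fy ->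
  C1 (fun x y => k * f x y) (fun x y => k * fx x y) (fun x y => k * fy x y).
Proof.
move=> H.
apply: C1_ext (C1_mult _ _ _ _ _ _ (C1_const k) H) => x y //=; ring.
Qed.

Lemma C1_minus (f fx fy g gx gy : R -> R -> R) :
  C1 f fx fy -> C1 g gx gy ->
  C1 (fun x y => f x y - g x y)
     (fun x y => fx x y - gx x y) (fun x y => fy x y - gy x y).
Proof.
move=> Hf Hg.
apply: C1_ext (C1_plus _ _ _ _ _ _ Hf (C1_scal (-1) _ _ _ Hg)) => x y; ring.
Qed.

Lemma derive0_const (f : R -> R) (a b : R) :
  (forall t, is_derive f t 0) -> f a = f b.
Proof.
move=> H; have [c [_ Hc]] := MVT_gen f b a (fun=> 0) (fun t _ => H t)
  (fun t _ => proj2 (continuity_pt_filterlim f t)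
     (ex_derive_continuous f t (ex_intro _ _ (H t)))).
by lra.
Qed.

Lemma C1_grad0 (f : R -> R -> R) (fx fy : R -> R -> R) (x y u v : R) :
  C1 f fx fy -> (forall x y, fx x y = 0) -> (forall x y, fy x y = 0) ->
  f x y = f u v.
Proof.
move=> H Hx Hy; transitivity (f u y).
- by apply: (derive0_const (fun t => f t y)) => t; rewrite -(Hx t y); exact: C1_dx H.
- by apply: (derive0_const (fun t => f u t)) => t; rewrite -(Hy u t); exact: C1_dy H.
Qed.

Lemma C1_grad_const (f fx fy : R -> R -> R) (a b : R) :
  C1 f fx fy -> (forall x y, fx x y = a) -> (forall x y, fy x y = b) ->
  forall x y, f x y = a * x + b * y + f 0 0.
Proof.
move=> H Hx Hy x y.
have H1 := C1_minus _ _ _ _ _ _ H (C1_linear a b 0).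
have := C1_grad0 _ _ _ x y 0 0 H1
  (fun u v => Rminus_diag_eq _ _ (Hx u v)) (fun u v => Rminus_diag_eq _ _ (Hy u v)).
lra.
Qed.

Lemma continuous_slice_y (f : R -> R -> R) (x y : R) :
  continuity_2d_pt f x y -> continuous (fun t => f x t) y.
Proof.
move=> H; apply: (continuous_of_2d f (fun=> x) (fun t => t)) => //.
exact: continuous_const.
Qed.

Lemma continuous_slice_x (f : R -> R -> R) (x y : R) :
  continuity_2d_pt f x y -> continuous (fun t => f t y) x.
Proof.
move=> H; apply: (continuous_of_2d f (fun t => t) (fun=> y)) => //.
exact: continuous_const.
Qed.

Lemma is_derive_RInt_upper (f : R -> R) (a x : R) :
  (forall t, continuous f t) -> is_derive (fun b => RInt f a b) x (f x).
Proof.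
move=> H; apply: is_derive_RInt (H x).
apply: filter_forall => b; apply: RInt_correct.
by apply: ex_RInt_continuous => z _; exact: H.
Qed.

Lemma RInt_of_derive (f df : R -> R) (a b : R) :
  (forall t, is_derive f t (df t)) -> (forall t, continuous df t) ->
  RInt df a b = f b - f a.
Proof.
move=> Hd Hc; apply: is_RInt_unique.
by apply: is_RInt_derive => t _; [exact: Hd | exact: Hc].
Qed.

Lemma is_derive_RInt_x (f fx : R -> R -> R) (a b x : R) :
  (forall x t, is_derive (fun u => f u t) x (fx x t)) ->
  (forall x t, continuity_2d_pt f x t) -> (forall x t, continuity_2d_pt fx x t) ->
  is_derive (fun u => RInt (f u) a b) x (RInt (fx x) a b).
Proof.
move=> Hd Cf Cfx.
have HD : forall u t, Derive (fun z => f z t) u = fx u t.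
  by move=> u t; apply: is_derive_unique.
rewrite (RInt_ext (fx x) (fun t => Derive (fun u => f u t) x)); last first.
  by move=> t _; rewrite HD.
apply: is_derive_RInt_param.
- by apply: filter_forall => u t _; exists (fx u t).
- move=> t _; apply: continuity_2d_pt_ext (Cfx x t) => u v; by rewrite HD.
- apply: filter_forall => u; apply: ex_RInt_continuous => t _.
  exact: continuous_slice_y.
Qed.

(** Integrate [f] along the x-axis, then [g] vertically. Differentiating the second integral in x
    gives the integral of [gx] = [fy], which turns [f x 0] into [f x y]. *)
Lemma closed_form_exact (f fx fy g gx gy : R -> R -> R) :
  C1 f fx fy -> C1 g gx gy -> (forall x y, fy x y = gx x y) ->
  exists F, C1 F f g.
Proof.
move=> Hf Hg Hc.
have Cf x y := C1_cont _ _ _ x y Hf; have Cg x y := C1_cont _ _ _ x y Hg.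
exists (fun x y => RInt (fun s => f s 0) 0 x + RInt (g x) 0 y).
apply: C1_partials => // x y.
- have -> : f x y = f x 0 + (f x y - f x 0) by ring.
  apply: is_derive_plus.
    apply: (is_derive_RInt_upper (fun s => f s 0)) => t.
    exact: continuous_slice_x.
  have <- : RInt (gx x) 0 y = f x y - f x 0.
    rewrite (RInt_ext (gx x) (fy x)); last by move=> t _; rewrite Hc.
    apply: RInt_of_derive => t; first exact: C1_dy Hf.
    by apply: continuous_slice_y; case: (Hf x t) => _ [].
  apply: is_derive_RInt_x => // u t; first exact: C1_dx Hg.
  by case: (Hg u t) => _ [].
- have -> : g x y = 0 + g x y by ring.
  apply: is_derive_plus; first exact: is_derive_const.
  by apply: is_derive_RInt_upper => t; exact: continuous_slice_y.
Qed.

(** * Liouville theorems *)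

(* Cauchy-Riemann pair: a + i b is holomorphic, with derivative ax - i ay. *)
Definition CR (a b ax ay : R -> R -> R) : Prop :=
  C1 a ax ay /\ C1 b (fun x y => - ay x y) ax.

Lemma CR_translate (a b ax ay : R -> R -> R) (p q : R) :
  CR a b ax ay ->
  CR (fun x y => a (x + p) (y + q)) (fun x y => b (x + p) (y + q))
     (fun x y => ax (x + p) (y + q)) (fun x y => ay (x + p) (y + q)).
Proof.
move=> [Ha Hb].
have Hx : C1 (fun x y => x + p) (fun _ _ => 1) (fun _ _ => 0).
  by apply: C1_ext (C1_linear 1 0 p) => x y; ring.
have Hy : C1 (fun x y => y + q) (fun _ _ => 0) (fun _ _ => 1).
  by apply: C1_ext (C1_linear 0 1 q) => x y; ring.
split.
- by apply: C1_ext (C1_comp _ _ _ _ _ _ _ _ _ Ha Hx Hy) => x y //=; ring.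
- by apply: C1_ext (C1_comp _ _ _ _ _ _ _ _ _ Hb Hx Hy) => x y //=; ring.
Qed.

(** This is f(i z), whose x-derivative is [ay] at i z: an estimate of [ax] valid for all pairs
    yields one of [ay]. *)
Lemma CR_rotate (a b ax ay : R -> R -> R) :
  CR a b ax ay ->
  CR (fun x y => a (- y) x) (fun x y => b (- y) x)
     (fun x y => ay (- y) x) (fun x y => - ax (- y) x).
Proof.
move=> [Ha Hb].
have Hx : C1 (fun x y => - y) (fun _ _ => 0) (fun _ _ => -1).
  by apply: C1_ext (C1_linear 0 (-1) 0) => x y; ring.
have Hy : C1 (fun x y => x) (fun _ _ => 1) (fun _ _ => 0).
  by apply: C1_ext (C1_linear 1 0 0) => x y; ring.
split.
- by apply: C1_ext (C1_comp _ _ _ _ _ _ _ _ _ Ha Hx Hy) => x y //=; ring.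
- by apply: C1_ext (C1_comp _ _ _ _ _ _ _ _ _ Hb Hx Hy) => x y //=; ring.
Qed.

Lemma CR_minus (a b ax ay a' b' ax' ay' : R -> R -> R) :
  CR a b ax ay -> CR a' b' ax' ay' ->
  CR (fun x y => a x y - a' x y) (fun x y => b x y - b' x y)
     (fun x y => ax x y - ax' x y) (fun x y => ay x y - ay' x y).
Proof.
move=> [Ha Hb] [Ha' Hb']; split; first exact: C1_minus.
by apply: C1_ext (C1_minus _ _ _ _ _ _ Hb Hb') => x y //=; ring.
Qed.

Lemma is_derive_circle_mean (f fx fy : R -> R -> R) (w : R -> R) (r : R) :
  C1 f fx fy -> (forall t, continuous w t) ->
  is_derive (fun r => RInt (fun t => f (r * cos t) (r * sin t) * w t) 0 (2 * PI)) r
   (RInt (fun t => (fx (r * cos t) (r * sin t) * cos t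
                    + fy (r * cos t) (r * sin t) * sin t) * w t) 0 (2 * PI)).
Proof.
move=> Hf Cw.
have C1d (h : R -> R) (x t : R) : continuous h t ->
    continuity_2d_pt (fun _ s => h s) x t.
  move=> Hh; apply: (continuity_1d_2d_pt_comp h (fun _ s => s)).
    exact/continuity_pt_filterlim.
  exact: continuity_2d_pt_id2.
have Ccos (x t : R) := C1d cos x t (continuous_cos t).
have Csin (x t : R) := C1d sin x t (continuous_sin t).
have Cp (h : R -> R -> R) (x t : R) : (forall u v, continuity_2d_pt h u v) ->
    continuity_2d_pt (fun r s => h (r * cos s) (r * sin s)) x t.
  move=> Hh; apply: (continuity_2d_comp h (fun r s => r * cos s) (fun r s => r * sin s));
    [exact: Hh | by move: (Ccos x t) => ?; cont2 | by move: (Csin x t) => ?; cont2].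
have CW x t := C1d w x t (Cw t).
apply: (is_derive_RInt_x (fun r t => f (r * cos t) (r * sin t) * w t)
  (fun r t => (fx (r * cos t) (r * sin t) * cos t
                    + fy (r * cos t) (r * sin t) * sin t) * w t)) => x t.
- set k := w t.
  have H1 : is_derive (fun r => r * cos t) x (cos t) by auto_derive => //; ring.
  have H2 : is_derive (fun r => r * sin t) x (sin t) by auto_derive => //; ring.
  have H3 := C1_curve _ _ _ _ _ _ _ _ Hf H1 H2.
  set l := fx _ _ * _ + _ in H3 *.
  have -> : l * k = l * k + f (x * cos t) (x * sin t) * 0 by ring.
  exact: Derive.is_derive_mult H3 (is_derive_const k x).
- move: (CW x t) (Cp f x t (fun u v => C1_cont _ _ _ u v Hf)) => ? ?; cont2.
- have Hcx : forall u v, continuity_2d_pt fx u v by move=> u v; case: (Hf u v) => _ [].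
  have Hcy : forall u v, continuity_2d_pt fy u v by move=> u v; case: (Hf u v) => _ [].
  move: (CW x t) (Cp fx x t Hcx) (Cp fy x t Hcy) (Ccos x t) (Csin x t) => *; cont2.
Qed.

(* [ring] and [field] reject an equation typed in a Coquelicot structure over R. *)
Ltac eqR := match goal with |- ?a = ?b => change (@eq R a b) end.

(** Integration by parts in the angle; the boundary terms cancel by periodicity. For a
    Cauchy-Riemann pair the angular derivative of one component is, up to sign, r times the radial
    derivative of the other, so this links the two circle means. *)
Lemma circle_parts (f fx fy : R -> R -> R) (w dw : R -> R) (r : R) :
  C1 f fx fy -> (forall t, is_derive w t (dw t)) -> (forall t, continuous dw t) ->
  w (2 * PI) = w 0 ->
  RInt (fun t => f (r * cos t) (r * sin t) * dw t) 0 (2 * PI) =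
  r * RInt (fun t => (fx (r * cos t) (r * sin t) * sin t
                      - fy (r * cos t) (r * sin t) * cos t) * w t) 0 (2 * PI).
Proof.
move=> Hf Hw Cdw Pw.
have Hc t : is_derive (fun s => r * cos s) t (- r * sin t).
  by auto_derive => //; ring.
have Hs t : is_derive (fun s => r * sin s) t (r * cos t).
  by auto_derive => //; ring.
have CC (h : R -> R -> R) t : (forall u v, continuity_2d_pt h u v) ->
    continuous (fun s => h (r * cos s) (r * sin s)) t.
  move=> Hh; apply: continuous_of_2d => //.
  - by apply: ex_derive_continuous; exists (- r * sin t); apply: Hc.
  - by apply: ex_derive_continuous; exists (r * cos t); apply: Hs.
have Cf := CC f _ (fun u v => C1_cont _ _ _ u v Hf).
have Cfx := CC fx _ (fun u v => proj1 (proj2 (Hf u v))).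
have Cfy := CC fy _ (fun u v => proj2 (proj2 (Hf u v))).
have Cw t : continuous w t by apply: ex_derive_continuous; exists (dw t).
set u := fun t => f (r * cos t) (r * sin t) * dw t.
set v := fun t => (_ - _) * w t.
have Cu t : continuous u t by apply: continuous_mult.
have Cv t : continuous v t.
  apply: continuous_mult => //; apply: continuous_minus; apply: continuous_mult => //.
  - exact: continuous_sin.
  - exact: continuous_cos.
have Iu : ex_RInt u 0 (2 * PI) by apply: ex_RInt_continuous.
have Iv : ex_RInt v 0 (2 * PI) by apply: ex_RInt_continuous.
have HR : RInt (fun t => minus (u t) (scal r (v t))) 0 (2 * PI) = 0.
  transitivity (f (r * cos (2 * PI)) (r * sin (2 * PI)) * w (2 * PI)
     - f (r * cos 0) (r * sin 0) * w 0).
  - apply: (RInt_of_derive (fun t => f (r * cos t) (r * sin t) * w t)).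
    + move=> t; have H3 := C1_curve _ _ _ _ _ _ _ _ Hf (Hc t) (Hs t).
      have H4 := Derive.is_derive_mult _ _ _ _ _ H3 (Hw t).
      have <- : (fx (r * cos t) (r * sin t) * (- r * sin t) +
          fy (r * cos t) (r * sin t) * (r * cos t)) * w t +
          f (r * cos t) (r * sin t) * dw t = minus (u t) (scal r (v t)).
        rewrite /u /v /minus /plus /opp /scal /= /mult /=; ring.
      exact: H4.
    + move=> t; apply: continuous_minus => //.
      by apply: continuous_scal_r.
  - rewrite Pw sin_2PI cos_2PI sin_0 cos_0; eqR; ring.
have Irv : ex_RInt (fun t => scal r (v t)) 0 (2 * PI) by apply: ex_RInt_scal.
rewrite RInt_minus // RInt_scal // in HR.
rewrite /minus /plus /opp /scal /= /mult /= in HR.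
lra.
Qed.

(* P = int a cos and Q = int b sin satisfy r P' = Q and r Q' = P. *)
Lemma CR_circle_mean (a b ax ay : R -> R -> R) (r : R) :
  CR a b ax ay -> 0 < r ->
  RInt (fun t => a (r * cos t) (r * sin t) * cos t) 0 (2 * PI) = PI * r * ax 0 0.
Proof.
move=> [Ha Hb] r0.
pose P : R -> R := fun r => RInt (fun t => a (r * cos t) (r * sin t) * cos t) 0 (2 * PI).
pose Q : R -> R := fun r => RInt (fun t => b (r * cos t) (r * sin t) * sin t) 0 (2 * PI).
pose P1 r : R := RInt (fun t => (ax (r * cos t) (r * sin t) * cos t
  + ay (r * cos t) (r * sin t) * sin t) * cos t) 0 (2 * PI).
pose Q1 r : R := RInt (fun t => (- ay (r * cos t) (r * sin t) * cos t
  + ax (r * cos t) (r * sin t) * sin t) * sin t) 0 (2 * PI).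
have HP s : is_derive P s (P1 s).
  exact: is_derive_circle_mean Ha continuous_cos.
have HQ s : is_derive Q s (Q1 s).
  exact: is_derive_circle_mean Hb continuous_sin.
have EP s : s * P1 s = Q s.
  have H := circle_parts b _ _ (fun t => - cos t) sin s Hb.
  rewrite /Q H; first last.
  - by rewrite cos_2PI cos_0.
  - exact: continuous_sin.
  - by move=> t; auto_derive => //; ring.
  - by congr (_ * _); apply: RInt_ext => t _; eqR; ring.
have EQ s : s * Q1 s = P s.
  have H := circle_parts a _ _ sin cos s Ha.
  rewrite /P H; first last.
  - by rewrite sin_2PI sin_0.
  - exact: continuous_cos.
  - by move=> t; auto_derive => //; ring.
  - by congr (_ * _); apply: RInt_ext => t _; eqR; ring.
(* The derivative is P - Q + s P' - s Q' = 0, and the factor s makes the constant 0. Hence P = Q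
   away from 0, and s P' = P. *)
have EPQ s : s * (P s - Q s) = 0.
  have D t : is_derive (fun s => s * (P s - Q s)) t 0.
    have D1 := is_derive_minus _ _ _ _ _ (HP t) (HQ t).
    have D2 := Derive.is_derive_mult _ _ _ _ _ (is_derive_id t) D1.
    have <- : one * (P t - Q t) + t * minus (P1 t) (Q1 t) = 0.
      rewrite /one /minus /plus /opp /=; move: (EP t) (EQ t); lra.
    exact: D2.
  by rewrite (derive0_const _ s 0 D); ring.
have P0 : P 0 = 0.
  rewrite /P (RInt_ext _ (fun t => a 0 0 * cos t)); last first.
    by move=> t _; rewrite !Rmult_0_l.
  rewrite (RInt_of_derive (fun t => a 0 0 * sin t)).
  - rewrite sin_2PI sin_0; eqR; ring.
  - by move=> t; auto_derive => //; ring.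
  - by move=> t; apply: continuous_scal_r; exact: continuous_cos.
have P10 : P1 0 = PI * ax 0 0.
  rewrite /P1 (RInt_ext _ (fun t => (ax 0 0 * cos t + ay 0 0 * sin t) * cos t)); last first.
    by move=> t _; rewrite !Rmult_0_l.
  rewrite (RInt_of_derive (fun t => ax 0 0 * (t + sin t * cos t) / 2
     + ay 0 0 * (sin t) ^ 2 / 2)).
  - rewrite sin_2PI sin_0; eqR; field.
  - move=> t; auto_derive => //.
    have := sin2_cos2 t; rewrite /Rsqr => H.
    apply: Rminus_diag_uniq.
    transitivity (ax 0 0 / 2 * (1 - (sin t * sin t + cos t * cos t))); first by field.
    by rewrite H; ring.
  - move=> t; apply: ex_derive_continuous; auto_derive => //.
(* P is linear on (0, oo), with slope its derivative at 0 *)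
have EPr s : 0 < s -> s * P1 s = P s.
  move=> s0; have := EPQ s => /Rmult_integral [|]; rewrite EP; lra.
have HL s : 0 < s <= r -> P s = s * (P r / r).
  move=> [s0 sr].
  have [] := MVT_gen (fun s => P s / s) s r (fun=> 0).
  - move=> x; rewrite Rmin_left // => -[x0 _].
    have xp : 0 < x by lra.
    have -> : 0 = (P1 x * x - P x * 1) / x ^ 2.
      by rewrite Rmult_comm EPr //; field; lra.
    apply: is_derive_div; [exact: HP|exact: is_derive_id|lra].
  - move=> x; rewrite Rmin_left // => -[x0 _].
    have xp : 0 < x by lra.
    apply/continuity_pt_filterlim.
    apply: (@ex_derive_continuous R_AbsRing R_NormedModule (fun s => P s / s)).
    apply: ex_derive_div; [by exists (P1 x)|exact: ex_derive_id|lra].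
  move=> c [_ Hc].
  have -> : P r / r = P s / s by lra.
  by field; lra.
(* By linearity the difference quotient of [P] at 0 equals [P r / r] for every step h in (0, r],
   while it tends to [P1 0]. *)
have : P r / r = P1 0.
  have HP0 := HP 0; move/is_derive_Reals: HP0 => HP0.
  apply: cond_eq => e e0.
  have [d Hd] := HP0 e e0.
  set h := Rmin (d / 2) r.
  have d0 := cond_pos d.
  have hp : 0 < h by apply: Rmin_glb_lt => //; lra.
  have hr : h <= r by apply: Rmin_r.
  have hd : h <= d / 2 by apply: Rmin_l.
  have := Hd h _ _.
  rewrite Rplus_0_l P0 (HL h) //.
  have -> : (h * (P r / r) - 0) / h - P1 0 = P r / r - P1 0 by field; lra.
  apply; first by lra.
  rewrite Rabs_pos_eq; lra.
rewrite P10 -/(P r) => H.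
have -> : P r = r * (P r / r) by field; lra.
by rewrite H; eqR; ring.
Qed.

(** In the circle formula about (p, q), |cos t| <= 1 bounds PI r |ax| by 2 PI M. Only [a] has to be
    bounded; its conjugate [b] may be arbitrarily large. *)
Lemma CR_gradient_x_bound (a b ax ay : R -> R -> R) (p q r M : R) :
  CR a b ax ay -> 0 < r ->
  (forall x y, (x - p) ^ 2 + (y - q) ^ 2 = r ^ 2 -> Rabs (a x y) <= M) ->
  Rabs (ax p q) <= 2 * M / r.
Proof.
move=> H r0 HM.
have H1 := CR_translate _ _ _ _ p q H.
have := CR_circle_mean _ _ _ _ r H1 r0; rewrite !Rplus_0_l => E.
have Pp := PI_RGT_0.
have : Rabs (PI * r * ax p q) <= (2 * PI - 0) * M.
  rewrite -E; apply: abs_RInt_le_const; first by lra.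
  - apply: ex_RInt_continuous => t _; apply: continuous_mult; last exact: continuous_cos.
    apply: (continuous_of_2d (fun x y => a (x + p) (y + q))).
    + by apply: C1_cont; exact: (proj1 H1).
    + by apply: ex_derive_continuous; auto_derive.
    + by apply: ex_derive_continuous; auto_derive.
  - move=> t _; rewrite Rabs_mult -[M]Rmult_1_r.
    apply: Rmult_le_compat; try exact: Rabs_pos.
    + apply: HM; have := sin2_cos2 t; rewrite /Rsqr => Ht.
      transitivity (r ^ 2 * (sin t * sin t + cos t * cos t)); first by ring.
      by rewrite Ht; ring.
    + by apply: Rabs_le; exact: COS_bound.
have k0 : 0 < PI * r by apply: Rmult_lt_0_compat.
rewrite Rabs_mult (Rabs_pos_eq (PI * r)); last lra.
move=> H2; apply: (Rmult_le_reg_l (PI * r)) => //.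
have -> : PI * r * (2 * M / r) = (2 * PI - 0) * M by field; lra.
exact: H2.
Qed.

Lemma CR_gradient_bound (a b ax ay : R -> R -> R) (p q r M : R) :
  CR a b ax ay -> 0 < r ->
  (forall x y, (x - p) ^ 2 + (y - q) ^ 2 = r ^ 2 -> Rabs (a x y) <= M) ->
  Rabs (ax p q) <= 2 * M / r /\ Rabs (ay p q) <= 2 * M / r.
Proof.
move=> H r0 HM; split; first exact: CR_gradient_x_bound H r0 HM.
(* The rotation takes (q, -p) to (p, q). *)
have := CR_gradient_x_bound _ _ _ _ q (- p) r M (CR_rotate _ _ _ _ H) r0.
cbv beta; rewrite Ropp_involutive; apply=> x y E; apply: HM.
by rewrite -E; ring.
Qed.

(** This is f = o(r^k), phrased with discs to match the norm in the theorem. For k = 0 it forces f =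
    0, since each point lies in all large discs. *)
Definition small_growth (k : nat) (f : R -> R -> R) : Prop :=
  forall eps : R, 0 < eps -> exists r0 : R, forall r x y : R,
    r0 < r -> x ^ 2 + y ^ 2 < r ^ 2 -> Rabs (f x y) <= eps * r ^ k.

(** Parallelogram law for X = (x, y) and P = (p, q): 2 |X - P|^2 + 2 |P|^2 - |X|^2 = |X - 2 P|^2. *)
Lemma disc_of_circle (p q r x y : R) :
  p ^ 2 + q ^ 2 < r ^ 2 -> (x - p) ^ 2 + (y - q) ^ 2 = r ^ 2 ->
  x ^ 2 + y ^ 2 < (2 * r) ^ 2.
Proof. have := pow2_ge_0 (x - 2 * p); have := pow2_ge_0 (y - 2 * q); nra. Qed.

Lemma CR_small_gradient (k : nat) (a b ax ay : R -> R -> R) :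
  CR a b ax ay -> small_growth k.+1 a -> small_growth k ax /\ small_growth k ay.
Proof.
move=> H Ha.
suff HH eps : 0 < eps -> exists r0 : R, forall r x y : R,
    r0 < r -> x ^ 2 + y ^ 2 < r ^ 2 ->
    Rabs (ax x y) <= eps * r ^ k /\ Rabs (ay x y) <= eps * r ^ k.
  by split=> eps e0; have [r0 H0] := HH eps e0; exists r0 => r x y h1 h2;
    case: (H0 r x y h1 h2).
move=> e0.
have k0 : 0 < 2 ^ k by apply: pow_lt; lra.
(* A circle of radius r about a point of B_r lies in B_(2r); the gradient bound 2 M / r with M =
   eps' (2 r)^(k+1) equals eps r^k for this eps'. *)
have e1 : 0 < eps / (4 * 2 ^ k) by apply: Rdiv_lt_0_compat; lra.
have [r0 H0] := Ha _ e1.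
exists (Rmax r0 0) => r x y hr hd.
have [hr1 hr2] : r0 < r /\ 0 < r.
  by move: hr (Rmax_l r0 0) (Rmax_r r0 0); lra.
have -> : eps * r ^ k = 2 * (eps / (4 * 2 ^ k) * (2 * r) ^ k.+1) / r.
  by rewrite Rpow_mult_distr -!tech_pow_Rmult; field; lra.
apply: (CR_gradient_bound a b ax ay) => // u v E.
apply: H0; first by lra.
exact: disc_of_circle E.
Qed.

Lemma CR_liouville (a b ax ay : R -> R -> R) :
  CR a b ax ay -> small_growth 1 a -> forall x y, ax x y = 0 /\ ay x y = 0.
Proof.
move=> H /(CR_small_gradient _ _ _ _ _ H) [Hx Hy] x y.
have small0 (f : R -> R -> R) : small_growth 0 f -> f x y = 0.
  move=> Hf; apply: cond_eq => e e0; rewrite Rminus_0_r.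
  have [r0 Hr] := Hf (e / 2) (ltac:(lra)).
  set r := Rmax r0 (x ^ 2 + y ^ 2) + 1.
  have h1 := Rmax_l r0 (x ^ 2 + y ^ 2); have h2 := Rmax_r r0 (x ^ 2 + y ^ 2).
  have h3 := pow2_ge_0 x; have h4 := pow2_ge_0 y.
  have := Hr r x y (ltac:(rewrite /r; lra)) (ltac:(rewrite /r; nra)).
  rewrite /=; lra.
by split; apply: small0.
Qed.

(** Since [ax] is only continuous, it is not differentiated: Liouville is applied to f(z + c) -
    f(z), bounded by the Lipschitz condition, with gradient at the origin [ax p q - ax 0 0] and
    [ay p q - ay 0 0]. *)
Lemma CR_lipschitz_affine (a b ax ay : R -> R -> R) (K : R) :
  CR a b ax ay ->
  (forall x y u v, Rabs (a x y - a u v) <= K * (Rabs (x - u) + Rabs (y - v))) ->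
  forall x y, ax x y = ax 0 0 /\ ay x y = ay 0 0.
Proof.
move=> H HL p q.
have HD := CR_minus _ _ _ _ _ _ _ _ (CR_translate _ _ _ _ p q H) H.
have [|E1 E2] := CR_liouville _ _ _ _ HD _ 0 0.
  move=> e e0; set M := K * (Rabs p + Rabs q).
  exists (M / e) => r x y hr _.
  have Hm := HL (x + p) (y + q) x y.
  have E1 : x + p - x = p by ring.
  have E2 : y + q - y = q by ring.
  rewrite E1 E2 -/M in Hm; apply: Rle_trans Hm _.
  have -> : M = e * (M / e) by field; lra.
  rewrite pow_1; apply: Rmult_le_compat_l; lra.
rewrite !Rplus_0_l in E1 E2; lra.
Qed.

(** Harmonicity makes -u_y dx + u_x dy closed, which provides a conjugate [v]; the pair (u, v) gives
    a gradient of growth o(r). [CR_small_gradient] does not place [ux] in a Cauchy-Riemann pair, so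
    the pair (u_x, -u_y) is formed from the second derivatives before Liouville is applied. *)
Lemma harmonic_liouville (u ux uy uxx uxy uyy : R -> R -> R) :
  C1 u ux uy -> C1 ux uxx uxy -> C1 uy uxy uyy ->
  (forall x y, uxx x y + uyy x y = 0) -> small_growth 2 u ->
  exists a b c, forall x y, u x y = a * x + b * y + c.
Proof.
move=> Hu Hux Huy HL Hg.
have HN : C1 (fun x y => -1 * uy x y) (fun x y => -1 * uxy x y) uxx.
  apply: C1_ext (C1_scal (-1) _ _ _ Huy) => // x y; move: (HL x y); lra.
have [v Hv] := closed_form_exact _ _ _ _ _ _ HN Hux (fun x y => erefl).
have HC1 : CR u v ux uy.
  by split => //; apply: C1_ext Hv => // x y; ring.
have [Gx _] := CR_small_gradient 1 _ _ _ _ HC1 Hg.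
have HC2 : CR ux (fun x y => -1 * uy x y) uxx uxy.
  by split => //; apply: C1_ext HN => // x y; ring.
have H0 := CR_liouville _ _ _ _ HC2 Gx.
exists (ux 0 0), (uy 0 0), (u 0 0); apply: C1_grad_const Hu _ _ => x y.
- by apply: C1_grad0 Hux _ _ => s t; case: (H0 s t).
- apply: C1_grad0 Huy _ _ => s t; case: (H0 s t) => // E _.
  by have := HL s t; lra.
Qed.

(** * Entire unimodular Hessians *)

(** Slope at least 1 gives g M >= g 0 + M and g (-M) <= g 0 - M, so [eta] is bracketed. The root
    comes as a [sig], so that it defines a function of parameters. *)
Lemma strongly_monotone_surj (g : R -> R) (eta : R) :
  (forall t, continuous g t) ->
  (forall s t, (s - t) ^ 2 <= (g s - g t) * (s - t)) -> {y | g y = eta}.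
Proof.
move=> Cg Hg; pose M := Rabs (eta - g 0) + 1.
have [Hm Hm'] : eta - g 0 <= M /\ - (eta - g 0) <= M.
  have := Rle_abs (eta - g 0); have := Rle_abs (- (eta - g 0)).
  by rewrite Rabs_Ropp /M; lra.
have M0 : 0 < M by have := Rabs_pos (eta - g 0); rewrite /M; lra.
have H1 : eta <= g M by have := Hg M 0; nra.
have H2 : g (- M) <= eta by have := Hg 0 (- M); nra.
have [] := IVT_gen g (- M) M eta.
- by move=> t; apply/continuity_pt_filterlim; exact: Cg.
- by rewrite Rmin_left ?Rmax_right; lra.
by move=> y [_ Hy]; exists y.
Qed.

Definition monotone2 (F G : R -> R -> R) : Prop := forall x y u v,
  0 <= (F x y - F u v) * (x - u) + (G x y - G u v) * (y - v).

(* Solve the second equation for y = s(x) at fixed x; monotonicity makes both s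
   and x |-> x + F(x, s(x)) continuous, and the latter strongly monotone. *)
Lemma id_plus_monotone_surj (F G : R -> R -> R) (xi eta : R) :
  (forall x y, continuity_2d_pt F x y) -> (forall x y, continuity_2d_pt G x y) ->
  monotone2 F G -> {p : R * R | p.1 + F p.1 p.2 = xi /\ p.2 + G p.1 p.2 = eta}.
Proof.
move=> CF CG Hm.
have Hs x : {y | y + G x y = eta}.
  apply: (strongly_monotone_surj (fun y => y + G x y)).
  - move=> t; apply: (continuous_plus (fun t => t) (G x)); first exact: continuous_id.
    exact: continuous_slice_y.
  - by move=> s t; have := Hm x s x t; nra.
pose s x := proj1_sig (Hs x).
have Es x : s x + G x (s x) = eta by rewrite /s; case: (Hs x).
have Cs x : continuous s x.
  have Cx := continuous_slice_x G x (s x) (CG x (s x)).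
  apply/filterlim_locally => e.
  move/filterlim_locally: Cx => /(_ e); apply: filter_imp => u.
  rewrite /ball /= /AbsRing_ball /abs /minus /plus /opp /= => Hu.
  apply: Rle_lt_trans Hu; apply: Rsqr_le_abs_0; rewrite /Rsqr.
  (* On the vertical line over u, put Delta = s u - s x and delta = G u (s x) - G x (s x).
     Monotonicity reads Delta^2 <= - delta Delta, whence |Delta| <= |delta|. *)
  have := Hm u (s u) u (s x).
  have -> : G u (s u) = s x + G x (s x) - s u by rewrite Es -(Es u); ring.
  have := pow2_ge_0 (s u - s x + (G u (s x) - G x (s x))); nra.
have [] := strongly_monotone_surj (fun x => x + F x (s x)) xi.
- move=> t; apply: (continuous_plus (fun t => t)); first exact: continuous_id.
  apply: (continuous_of_2d F (fun t => t) s) => //; exact: continuous_id.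
(* Along y = s x the increments of G are minus those of s, so monotonicity leaves (F - F') (a - b)
   >= (s a - s b)^2. *)
- move=> a b; have := Hm a (s a) b (s b).
  have -> : G a (s a) = eta - s a by rewrite -(Es a); ring.
  have -> : G b (s b) = eta - s b by rewrite -(Es b); ring.
  have := pow2_ge_0 (s a - s b); nra.
by move=> x Hx; exists (x, s x); split; [exact: Hx | exact: Es].
Qed.

Lemma form_nonneg (A B D p q : R) :
  0 < A -> A * D - B * B = 1 -> 0 <= A * p ^ 2 + 2 * B * p * q + D * q ^ 2.
Proof.
move=> A0 HD; apply: (Rmult_le_reg_l A) => //; rewrite Rmult_0_r.
have := pow2_ge_0 (A * p + B * q); have := pow2_ge_0 q; nra.
Qed.

(** [k] pairs (F, G) on the segment from (u, v) to (x, y) with its direction; k' is the positive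
    form of matrix (A, B; B, D), and the mean value theorem gives k 0 <= k 1. *)
Lemma gradient_monotone (F G A B D : R -> R -> R) :
  C1 F A B -> C1 G B D -> (forall x y, 0 < A x y) ->
  (forall x y, A x y * D x y - B x y * B x y = 1) -> monotone2 F G.
Proof.
move=> HF HG A0 HD x y u v.
pose g t := u + t * (x - u); pose h t := v + t * (y - v).
pose k t := F (g t) (h t) * (x - u) + G (g t) (h t) * (y - v).
pose dk t := A (g t) (h t) * (x - u) ^ 2 + 2 * B (g t) (h t) * (x - u) * (y - v)
   + D (g t) (h t) * (y - v) ^ 2.
have Hg t : is_derive g t (x - u) by rewrite /g; auto_derive => //; ring.
have Hh t : is_derive h t (y - v) by rewrite /h; auto_derive => //; ring.
have Hk t : is_derive k t (dk t).
  have KF := C1_curve _ _ _ _ _ _ _ _ HF (Hg t) (Hh t).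
  have KG := C1_curve _ _ _ _ _ _ _ _ HG (Hg t) (Hh t).
  have := is_derive_plus _ _ _ _ _ (is_derive_scal _ _ (x - u) _ KF)
    (is_derive_scal _ _ (y - v) _ KG).
  rewrite /plus /= => K.
  have -> : dk t = (x - u) * (A (g t) (h t) * (x - u) + B (g t) (h t) * (y - v)) +
       (y - v) * (B (g t) (h t) * (x - u) + D (g t) (h t) * (y - v)).
    rewrite /dk; ring.
  by apply: is_derive_ext K => s; rewrite /k; eqR; ring.
have [] := MVT_gen k 0 1 dk.
- by move=> t _; exact: Hk.
- move=> t _; apply/continuity_pt_filterlim.
  by apply: (@ex_derive_continuous R_AbsRing R_NormedModule k); exists (dk t).
move=> c [_]; have := form_nonneg _ _ _ (x - u) (y - v) (A0 (g c) (h c)) (HD (g c) (h c)).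
rewrite -/(dk c) /k /g /h !Rmult_0_l !Rplus_0_r !Rmult_1_l.
have -> : u + (x - u) = x by ring.
have -> : v + (y - v) = y by ring.
lra.
Qed.

Lemma Rabs_le_of_sqr_sum (p s t : R) : p ^ 2 <= s ^ 2 + t ^ 2 -> Rabs p <= Rabs s + Rabs t.
Proof.
move=> H; have Hs := Rabs_pos s; have Ht := Rabs_pos t.
rewrite -(pow2_abs p) -(pow2_abs s) -(pow2_abs t) in H; have := Rabs_pos p; nra.
Qed.

(* With T = id + (F, G) and S its inverse, the Jacobian of S is
   ((1 + D, -B), (-B, 1 + A)) / (2 + A + D) because A D - B^2 = 1. *)
Lemma inverse_C1 (F G A B D S1 S2 : R -> R -> R) :
  C1 F A B -> C1 G B D -> (forall x y, 0 < A x y) -> (forall x y, 0 < D x y) ->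
  (forall x y, A x y * D x y - B x y * B x y = 1) -> monotone2 F G ->
  (forall s t, S1 s t + F (S1 s t) (S2 s t) = s) ->
  (forall s t, S2 s t + G (S1 s t) (S2 s t) = t) ->
  let J x y := 2 + A x y + D x y in
  (forall s t s' t', Rabs (S1 s t - S1 s' t') <= Rabs (s - s') + Rabs (t - t')) /\
  C1 S1 (fun s t => (1 + D (S1 s t) (S2 s t)) / J (S1 s t) (S2 s t))
        (fun s t => - B (S1 s t) (S2 s t) / J (S1 s t) (S2 s t)) /\
  C1 S2 (fun s t => - B (S1 s t) (S2 s t) / J (S1 s t) (S2 s t))
        (fun s t => (1 + A (S1 s t) (S2 s t)) / J (S1 s t) (S2 s t)).
Proof.
move=> HF HG A0 D0 HD Hm E1 E2 J.
(* T expands distances: in |dS + d(F, G)|^2 the cross term is nonnegative by monotonicity. So S is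
   1-Lipschitz. *)
have L2 s t s' t' : (S1 s t - S1 s' t') ^ 2 + (S2 s t - S2 s' t') ^ 2
    <= (s - s') ^ 2 + (t - t') ^ 2.
  have := Hm (S1 s t) (S2 s t) (S1 s' t') (S2 s' t').
  move: (E1 s t) (E2 s t) (E1 s' t') (E2 s' t').
  move: (F (S1 s t) _) (F (S1 s' t') _) (G (S1 s t) _) (G (S1 s' t') _) => f1 f2 g1 g2.
  move: (S1 s t) (S2 s t) (S1 s' t') (S2 s' t') => x1 y1 x2 y2 <- <- <- <-.
  have := pow2_ge_0 (f1 - f2); have := pow2_ge_0 (g1 - g2); nra.
have L1 s t s' t' : Rabs (S1 s t - S1 s' t') <= Rabs (s - s') + Rabs (t - t').
  apply: Rabs_le_of_sqr_sum; have := L2 s t s' t'.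
  by have := pow2_ge_0 (S2 s t - S2 s' t'); lra.
have L3 s t s' t' : Rabs (S2 s t - S2 s' t') <= Rabs (s - s') + Rabs (t - t').
  apply: Rabs_le_of_sqr_sum; have := L2 s t s' t'.
  by have := pow2_ge_0 (S1 s t - S1 s' t'); lra.
have CL (h : R -> R -> R) s t : (forall s t s' t',
    Rabs (h s t - h s' t') <= Rabs (s - s') + Rabs (t - t')) -> continuity_2d_pt h s t.
  move=> Hh e; have e2 : 0 < e / 2 by have := cond_pos e; lra.
  exists (mkposreal _ e2) => u v /= Hu Hv; have := Hh u v s t; lra.
have CS1 s t := CL S1 s t L1; have CS2 s t := CL S2 s t L3.
have J0 x y : 0 < J x y by rewrite /J; move: (A0 x y) (D0 x y); lra.
have C0 (h : R -> R -> R) s t : (forall x y, continuity_2d_pt h x y) ->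
    continuity_2d_pt (fun s t => h (S1 s t) (S2 s t)) s t.
  by move=> Hh; apply: continuity_2d_comp.
have CA s t := C0 A s t (fun x y => proj1 (proj2 (HF x y))).
have CB s t := C0 B s t (fun x y => proj2 (proj2 (HF x y))).
have CD s t := C0 D s t (fun x y => proj2 (proj2 (HG x y))).
have CJ s t : continuity_2d_pt (fun s t => / J (S1 s t) (S2 s t)) s t.
  apply: continuity_2d_pt_inv; last by apply: Rgt_not_eq; exact: J0.
  by move: (CA s t) (CD s t) => *; rewrite /J; cont2.
have CN (h : R -> R -> R) s t : continuity_2d_pt h s t ->
    continuity_2d_pt (fun s t => h s t / J (S1 s t) (S2 s t)) s t.
  by move=> Hh; apply: continuity_2d_pt_mult.
have CC1 s t := CN _ s t (continuity_2d_pt_plus _ _ _ _ (continuity_2d_pt_const s t 1) (CD s t)).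
have CC2 s t := CN _ s t (continuity_2d_pt_opp _ _ _ (CB s t)).
have CC3 s t := CN _ s t (continuity_2d_pt_plus _ _ _ _ (continuity_2d_pt_const s t 1) (CA s t)).
have key s t (e : posreal) : locally_2d (fun u v => 
    Rabs (S1 u v - S1 s t - ((1 + D (S1 s t) (S2 s t)) / J (S1 s t) (S2 s t) * (u - s)
      + - B (S1 s t) (S2 s t) / J (S1 s t) (S2 s t) * (v - t)))
      <= e * Rmax (Rabs (u - s)) (Rabs (v - t)) /\
    Rabs (S2 u v - S2 s t - (- B (S1 s t) (S2 s t) / J (S1 s t) (S2 s t) * (u - s)
      + (1 + A (S1 s t) (S2 s t)) / J (S1 s t) (S2 s t) * (v - t)))
      <= e * Rmax (Rabs (u - s)) (Rabs (v - t))) s t.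
  (* One factor 2 is lost in the bound of the increments of S by the maximum norm, another in adding
     the remainders of F and G. The radius is halved below for the first reason. *)
  have e4 : 0 < e / 4 by have := cond_pos e; lra.
  have [d1 H1] := proj1 (HF (S1 s t) (S2 s t)) (mkposreal _ e4).
  have [d2 H2] := proj1 (HG (S1 s t) (S2 s t)) (mkposreal _ e4).
  set d := Rmin d1 d2 / 2.
  have dd : 0 < d.
    have : 0 < Rmin d1 d2 by apply: Rmin_glb_lt; exact: cond_pos.
    by rewrite /d; lra.
  exists (mkposreal d dd) => u v /= Hu Hv.
  have M1 := Rmax_l (Rabs (u - s)) (Rabs (v - t)).
  have M2 := Rmax_r (Rabs (u - s)) (Rabs (v - t)).
  move: (L1 u v s t) (L3 u v s t) (Rmin_l d1 d2) (Rmin_r d1 d2) => B1 B2 B3 B4.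
  rewrite /d in Hu Hv.
  have := H1 (S1 u v) (S2 u v) ltac:(lra) ltac:(lra).
  have := H2 (S1 u v) (S2 u v) ltac:(lra) ltac:(lra).
  have M3 : Rmax (Rabs (S1 u v - S1 s t)) (Rabs (S2 u v - S2 s t))
     <= 2 * Rmax (Rabs (u - s)) (Rabs (v - t)) by apply: Rmax_lub; lra.
  move: (E1 u v) (E2 u v) (E1 s t) (E2 s t).
  move: (A0 (S1 s t) (S2 s t)) (D0 (S1 s t) (S2 s t)) (HD (S1 s t) (S2 s t))
    (J0 (S1 s t) (S2 s t)) M3.
  rewrite /J /=.
  set m := Rmax (Rabs (u - s)) _; set m' := Rmax _ _.
  move: m m' (A _ _) (B _ _) (D _ _) (F (S1 u v) _) (F (S1 s t) _) (G (S1 u v) _)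
    (G (S1 s t) _) => m m' a b c f1 f2 g1 g2.
  move: (S1 u v) (S2 u v) (S1 s t) (S2 s t)
    => x1 y1 x2 y2 a0 c0 Hd j0 M3 <- <- <- <- K2 K1.
  have b1 : b <= 2 + a + c by have := pow2_ge_0 (a - c); nra.
  have b2 : - b <= 2 + a + c by have := pow2_ge_0 (a - c); nra.
  have e0 := cond_pos e.
  have N1 : Rabs (f1 - f2 - (a * (x1 - x2) + b * (y1 - y2))) <= e / 2 * m by nra.
  have N2 : Rabs (g1 - g2 - (b * (x1 - x2) + c * (y1 - y2))) <= e / 2 * m by nra.
  move: N1 N2; set r1 := _ - _ - _; set r2 := g1 - g2 - _ => N1 N2.
  (* The remainders of S are those of F and G multiplied by minus the inverse Jacobian. Since b^2 =
     a c - 1, the entries 1 + a, b, 1 + c of its numerator are at most J = 2 + a + c in absolute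
     value, so its entries are at most 1. *)
  have bd p q : Rabs p <= 2 + a + c -> Rabs q <= 2 + a + c ->
      Rabs ((p * r1 + q * r2) / (2 + a + c)) <= e * m.
    move=> P Q; rewrite Rabs_div ?(Rabs_pos_eq (2 + a + c)); try lra.
    apply/Rle_div_l; first by lra.
    apply: Rle_trans (Rabs_triang _ _) _; rewrite !Rabs_mult.
    have := Rabs_pos r1; have := Rabs_pos r2; have := Rabs_pos p; have := Rabs_pos q.
    nra.
  split.
  - have := bd (- (1 + c)) b _ _.
    have -> : (- (1 + c) * r1 + b * r2) / (2 + a + c) =
      x1 - x2 - ((1 + c) / (2 + a + c) * (x1 + f1 - (x2 + f2)) +
        - b / (2 + a + c) * (y1 + g1 - (y2 + g2))).
      rewrite /r1 /r2; field_simplify; try lra.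
      congr (_ / _); have -> : b ^ 2 = a * c - 1 by lra.
      ring.
    by apply; apply: Rabs_le; lra.
  - have := bd b (- (1 + a)) _ _.
    have -> : (b * r1 + - (1 + a) * r2) / (2 + a + c) =
      y1 - y2 - (- b / (2 + a + c) * (x1 + f1 - (x2 + f2)) +
        (1 + a) / (2 + a + c) * (y1 + g1 - (y2 + g2))).
      rewrite /r1 /r2; field_simplify; try lra.
      congr (_ / _); have -> : b ^ 2 = a * c - 1 by lra.
      ring.
    by apply; apply: Rabs_le; lra.
split; first exact: L1.
split=> s t; (split; last by split).
- by move=> e; apply: locally_2d_impl (key s t e); apply: locally_2d_forall => u v [].
- by move=> e; apply: locally_2d_impl (key s t e); apply: locally_2d_forall => u v [].
Qed.

(* Joergens: with z = x + i y and T = id + (F, G), the function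
   conj (2 z - T z) is an entire Lipschitz function of T z, hence affine. *)
Lemma unimodular_hessian_const (A Ax Ay B Bx By D Dx Dy : R -> R -> R) :
  C1 A Ax Ay -> C1 B Bx By -> C1 D Dx Dy ->
  (forall x y, Ay x y = Bx x y) -> (forall x y, By x y = Dx x y) ->
  (forall x y, 0 < A x y) -> (forall x y, 0 < D x y) ->
  (forall x y, A x y * D x y - B x y * B x y = 1) ->
  exists a b d, forall x y, A x y = a /\ B x y = b /\ D x y = d.
Proof.
move=> HA HB HD E1 E2 A0 D0 Hdet.
have [F HF] := closed_form_exact _ _ _ _ _ _ HA HB E1.
have [G HG] := closed_form_exact _ _ _ _ _ _ HB HD E2.
have Hm := gradient_monotone _ _ _ _ _ HF HG A0 Hdet.
have HS s t := id_plus_monotone_surj F G s t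
  (fun x y => C1_cont _ _ _ x y HF) (fun x y => C1_cont _ _ _ x y HG) Hm.
pose S1 s t := (proj1_sig (HS s t)).1; pose S2 s t := (proj1_sig (HS s t)).2.
have T1 s t : S1 s t + F (S1 s t) (S2 s t) = s by rewrite /S1 /S2; case: (HS s t) => p [].
have T2 s t : S2 s t + G (S1 s t) (S2 s t) = t by rewrite /S1 /S2; case: (HS s t) => p [].
have [L [C1' C2']] := inverse_C1 F G A B D S1 S2 HF HG A0 D0 Hdet Hm T1 T2.
pose J s t := 2 + A (S1 s t) (S2 s t) + D (S1 s t) (S2 s t).
have J0 s t : 0 < J s t by rewrite /J; move: (A0 (S1 s t) (S2 s t)) (D0 (S1 s t) (S2 s t)); lra.
pose p s t := (D (S1 s t) (S2 s t) - A (S1 s t) (S2 s t)) / J s t.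
pose q s t := - 2 * B (S1 s t) (S2 s t) / J s t.
have HCR : CR (fun s t => 2 * S1 s t - s) (fun s t => t - 2 * S2 s t) p q.
  have X1 : C1 (fun s t => s) (fun _ _ => 1) (fun _ _ => 0).
    by apply: C1_ext (C1_linear 1 0 0) => *; ring.
  have X2 : C1 (fun s t => t) (fun _ _ => 0) (fun _ _ => 1).
    by apply: C1_ext (C1_linear 0 1 0) => *; ring.
  split.
  - apply: C1_ext (C1_minus _ _ _ _ _ _ (C1_scal 2 _ _ _ C1') X1) => // s t;
    rewrite /p /q; move: (J0 s t); rewrite /J => ?; field; lra.
  - apply: C1_ext (C1_minus _ _ _ _ _ _ X2 (C1_scal 2 _ _ _ C2')) => // s t;
    rewrite /p /q; move: (J0 s t); rewrite /J => ?; field; lra.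
(* The Lipschitz constant 3 is 2 for [2 * S1] plus 1 for the identity. *)
have [|Hp Hq] := all_and2 (fun s => all_and2 (CR_lipschitz_affine _ _ _ _ 3 HCR _ s)).
  move=> x y u v.
  have -> : 2 * S1 x y - x - (2 * S1 u v - u) = 2 * (S1 x y - S1 u v) + - (x - u) by ring.
  apply: Rle_trans (Rabs_triang _ _) _; rewrite Rabs_mult Rabs_Ropp (Rabs_pos_eq 2); last lra.
  by have := L x y u v; have := Rabs_pos (x - u); have := Rabs_pos (y - v); lra.
(* p and q determine J, because p^2 + q^2 = 1 - 4 / J. *)
have HJ s t : J s t = 4 / (1 - p 0 0 ^ 2 - q 0 0 ^ 2).
  rewrite -(Hp s t) -(Hq s t).
  have E : 1 - p s t ^ 2 - q s t ^ 2 = 4 / J s t.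
    rewrite /p /q; move: (J0 s t) (Hdet (S1 s t) (S2 s t)); rewrite /J => Jp Hd.
    move: (A _ _) (B _ _) (D _ _) Jp Hd => a b d Jp Hd.
    transitivity (((2 + a + d) ^ 2 - (d - a) ^ 2 - 4 * (b * b)) / (2 + a + d) ^ 2).
      by field; lra.
    have -> : b * b = a * d - 1 by lra.
    by field; lra.
  by rewrite E; field; have := J0 s t; lra.
set j := 4 / _ in HJ.
(* Solution of A + D = J - 2, D - A = p J, -2 B = q J. *)
exists ((j - 2 - p 0 0 * j) / 2), (- q 0 0 * j / 2), ((j - 2 + p 0 0 * j) / 2) => x y.
set s := x + F x y; set t := y + G x y.
(* Injectivity of T: two points with the same image have opposite increments of (F, G), so
   monotonicity gives 0 <= - |difference|^2. *)
have [X1 X2] : S1 s t = x /\ S2 s t = y.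
  have := Hm (S1 s t) (S2 s t) x y.
  have -> : F (S1 s t) (S2 s t) - F x y = x - S1 s t.
    by have := T1 s t; have Es : s = x + F x y by []; lra.
  have -> : G (S1 s t) (S2 s t) - G x y = y - S2 s t.
    by have := T2 s t; have Et : t = y + G x y by []; lra.
  move=> Hle.
  have Q1 := pow2_ge_0 (x - S1 s t); have Q2 := pow2_ge_0 (y - S2 s t).
  have Z1 : (x - S1 s t) ^ 2 = 0 by nra.
  have Z2 : (y - S2 s t) ^ 2 = 0 by nra.
  have sq0 z : z ^ 2 = 0 -> z = 0 by move=> Hz; apply: Rsqr_0_uniq; rewrite Rsqr_pow2.
  by have := sq0 _ Z1; have := sq0 _ Z2; lra.
rewrite -(HJ s t) -(Hp s t) -(Hq s t) /p /q; have := J0 s t.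
rewrite /J X1 X2 => ?; split; [|split]; field; lra.
Qed.

(** * Minimal graphs *)

HB.instance Definition _ := Monoid.isComLaw.Build R 0 Rplus
  (fun x y z => esym (Rplus_assoc x y z)) Rplus_comm Rplus_0_l.

Section FiniteSums.

Variable I : finType.
Implicit Types f g : I -> R.

Lemma big_Rplus_ge0 f : (forall i, 0 <= f i) -> 0 <= \big[Rplus/0]_i f i.
Proof. move=> H; elim/big_rec: _ => [|i x _]; [lra | have := H i; lra]. Qed.

Lemma big_Rplus_scal (k : R) f :
  \big[Rplus/0]_i (k * f i) = k * \big[Rplus/0]_i f i.
Proof. by elim/big_rec2: _ => [|i x y _ ->]; ring. Qed.

Lemma big_Rplus_delta f (k : R) (s : I) :
  \big[Rplus/0]_i (f i * (if i == s then k else 0)) = f s * k.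
Proof.
rewrite (bigD1 s) //= eqxx big1 ?Rplus_0_r // => i /negbTE ->; ring.
Qed.

Lemma big_Rplus_sqr_ge f (s : I) : f s ^ 2 <= \big[Rplus/0]_i (f i * f i).
Proof.
rewrite (bigD1 s) //=.
have : 0 <= \big[Rplus/0]_(i | i != s) (f i * f i).
  by elim/big_rec: _ => [|i x _]; [lra | have := pow2_ge_0 (f i); lra].
lra.
Qed.

Lemma big_Rplus_cauchy_schwarz f g :
  (\big[Rplus/0]_i (f i * g i)) ^ 2
  <= \big[Rplus/0]_i (f i * f i) * \big[Rplus/0]_i (g i * g i).
Proof.
set P := \big[Rplus/0]_i (f i * f i); set Q := \big[Rplus/0]_i (g i * g i).
set D := \big[Rplus/0]_i _.
have H a b : 0 <= a ^ 2 * P + 2 * a * b * D + b ^ 2 * Q.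
  have <- : \big[Rplus/0]_i ((a * f i + b * g i) ^ 2)
      = a ^ 2 * P + 2 * a * b * D + b ^ 2 * Q.
    rewrite /P /D /Q -!big_Rplus_scal -!big_split /=.
    by apply: eq_bigr => i _; ring.
  by apply: big_Rplus_ge0 => i; exact: pow2_ge_0.
have P0 : 0 <= P by apply: big_Rplus_ge0 => i; have := pow2_ge_0 (f i); lra.
have Q0 : 0 <= Q by apply: big_Rplus_ge0 => i; have := pow2_ge_0 (g i); lra.
case: (Rle_lt_or_eq_dec _ _ P0) => [Pp|Pz].
  (* These coefficients turn the form into P (P Q - D^2). *)
  have := H (- D) P => H1; apply: (Rmult_le_reg_l P) => //; nra.
rewrite -Pz Rmult_0_l.
case: (Req_dec D 0) => [-> | Dn]; first by lra.
(* If P = 0 and D is nonzero, the form takes the value -(Q + 1) + Q = -1 here. *)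
have := H (- (Q + 1) / (2 * D)) 1; rewrite -Pz.
have -> : 2 * (- (Q + 1) / (2 * D)) * 1 * D = - (Q + 1) by field.
lra.
Qed.

Lemma C1_sum (f fx fy : I -> R -> R -> R) :
  (forall i, C1 (f i) (fx i) (fy i)) ->
  C1 (fun x y => \big[Rplus/0]_i f i x y) (fun x y => \big[Rplus/0]_i fx i x y)
     (fun x y => \big[Rplus/0]_i fy i x y).
Proof.
move=> H; elim: (index_enum I) => [|i r IH].
  by apply: C1_ext (C1_const 0) => x y; rewrite big_nil.
by apply: C1_ext (C1_plus _ _ _ _ _ _ (H i) IH) => x y; rewrite big_cons.
Qed.

End FiniteSums.

Lemma C1_sqrt_inv (f fx fy : R -> R -> R) :
  C1 f fx fy -> (forall x y, 0 < f x y) ->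
  C1 (fun x y => / sqrt (f x y))
     (fun x y => - (fx x y) / (2 * f x y * sqrt (f x y)))
     (fun x y => - (fy x y) / (2 * f x y * sqrt (f x y))).
Proof.
move=> Hf f0.
have Hd z : 0 < z -> is_derive (fun z => / sqrt z) z (- / (2 * z * sqrt z)).
  move=> z0; have s0 := sqrt_lt_R0 _ z0.
  auto_derive; first by split=> //; split=> //; lra.
  rewrite -{4}(sqrt_sqrt z); last lra.
  by field; lra.
have Cd x y : continuity_2d_pt (fun x y => - / (2 * f x y * sqrt (f x y))) x y.
  apply: (continuity_1d_2d_pt_comp (fun z => - / (2 * z * sqrt z))).
    apply/continuity_pt_filterlim/ex_derive_continuous.
    have s0 := sqrt_lt_R0 _ (f0 x y); have := f0 x y => z0.
    auto_derive; split=> //; split=> //.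
    by apply: Rgt_not_eq; apply: Rmult_lt_0_compat; lra.
  exact: C1_cont Hf.
have N (h : R -> R -> R) x y : - h x y / (2 * f x y * sqrt (f x y)) =
    h x y * - / (2 * f x y * sqrt (f x y)).
  by rewrite /Rdiv; ring.
apply: C1_partials => x y.
- rewrite N; apply: (is_derive_comp (fun z => / sqrt z) (fun t => f t y)).
    exact: Hd.
  exact: C1_dx Hf.
- rewrite N; apply: (is_derive_comp (fun z => / sqrt z) (fun t => f x t)).
    exact: Hd.
  exact: C1_dy Hf.
- apply: (continuity_2d_pt_ext (fun x y => fx x y * - / (2 * f x y * sqrt (f x y)))).
    by move=> u v; rewrite (N fx).
  by apply: continuity_2d_pt_mult => //; case: (Hf x y) => _ [].
- apply: (continuity_2d_pt_ext (fun x y => fy x y * - / (2 * f x y * sqrt (f x y)))).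
    by move=> u v; rewrite (N fy).
  by apply: continuity_2d_pt_mult => //; case: (Hf x y) => _ [].
Qed.

(** Schwarz's theorem lets one mixed derivative serve both as (f_x)_y and as (f_y)_x. *)
Lemma is_C2_C1 (f : R -> R -> R) : is_C2 f ->
  C1 f (partial_derive 1 0 f) (partial_derive 0 1 f) /\
  C1 (partial_derive 1 0 f) (partial_derive 2 0 f) (partial_derive 1 1 f) /\
  C1 (partial_derive 0 1 f) (partial_derive 1 1 f) (partial_derive 0 2 f).
Proof.
move=> H.
have S x y : Derive (fun z => Derive (fun t => f z t) y) x
    = Derive (fun z => Derive (fun t => f t z) x) y.
  apply: Schwarz.
  - apply: locally_2d_forall => u v.
    by case: (H u v) => _ [? [? [[_ [_ [? _]]] [_ [? _]]]]].
  - by case: (H x y) => _ [_ [_ [_ [_ [_ [_ [[? _] _]]]]]]].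
  - by case: (H x y) => _ [_ [_ [[_ [_ [_ [_ [? _]]]]] _]]].
split; [|split]; apply: C1_partials => x y;
  rewrite /partial_derive /= ?S; case: (H x y) =>
    _ [? [? [[? [? [? [[? _] [? _]]]]] [? [? [? [[? _] [? _]]]]]]]] //;
  try by apply: Derive_correct.
by rewrite -S; apply: Derive_correct.
Qed.

(** * The minimal surface system in Monge's notation p, q, r, s, t *)

Section MinimalSystem.

Variable I : finType.
Variables p q r s t : I -> R -> R -> R.
Hypothesis Cp : forall i, C1 (p i) (r i) (s i).
Hypothesis Cq : forall i, C1 (q i) (s i) (t i).

Let S (f g : I -> R -> R -> R) (x y : R) : R := \big[Rplus/0]_i (f i x y * g i x y).
Let g11 x y := 1 + S p p x y.
Let g12 x y := S p q x y.
Let g22 x y := 1 + S q q x y.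
Let g x y := g11 x y * g22 x y - g12 x y * g12 x y.

Hypothesis minimal : forall i x y,
  r i x y * g22 x y - 2 * s i x y * g12 x y + t i x y * g11 x y = 0.

Lemma pointwise_dot_sym (f h : I -> R -> R -> R) x y : S f h x y = S h f x y.
Proof. by apply: eq_bigr => i _; ring. Qed.

Lemma C1_pointwise_dot (f fx fy h hx hy : I -> R -> R -> R) :
  (forall i, C1 (f i) (fx i) (fy i)) -> (forall i, C1 (h i) (hx i) (hy i)) ->
  C1 (S f h) (fun x y => S fx h x y + S f hx x y) (fun x y => S fy h x y + S f hy x y).
Proof.
move=> Hf Hh.
apply: C1_ext (C1_sum _ _ _ _ (fun i => C1_mult _ _ _ _ _ _ (Hf i) (Hh i))) => x y //;
  by rewrite big_split.
Qed.

(** Expanded, [g] is 1 + |p|^2 + |q|^2 plus the Cauchy-Schwarz defect of p and q. *)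
Lemma gram_gt0 x y : 0 < g x y.
Proof.
have P0 : 0 <= S p p x y by apply: big_Rplus_ge0 => i; have := pow2_ge_0 (p i x y); lra.
have Q0 : 0 <= S q q x y by apply: big_Rplus_ge0 => i; have := pow2_ge_0 (q i x y); lra.
have := big_Rplus_cauchy_schwarz _ (fun i => p i x y) (fun i => q i x y).
rewrite -/(S p q x y) -/(S p p x y) -/(S q q x y) /g /g11 /g12 /g22; nra.
Qed.

Lemma minimal_dot (f : I -> R -> R -> R) x y :
  S f r x y * g22 x y - 2 * S f s x y * g12 x y + S f t x y * g11 x y = 0.
Proof.
have := fun i => minimal i x y; move: (g22 x y) (g12 x y) (g11 x y) => c b a H.
transitivity (c * S f r x y + (- 2 * b) * S f s x y + a * S f t x y); first by ring.
rewrite /S -!big_Rplus_scal -!big_split /= big1 // => i _.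
by rewrite -[RHS](Rmult_0_r (f i x y)) -(H i); ring.
Qed.

Lemma normalized_metric_const : exists a b d, forall x y,
  g11 x y = a * sqrt (g x y) /\ g12 x y = b * sqrt (g x y) /\ g22 x y = d * sqrt (g x y).
Proof.
have C11 := C1_plus _ _ _ _ _ _ (C1_const 1) (C1_pointwise_dot _ _ _ _ _ _ Cp Cp).
have C12 := C1_pointwise_dot _ _ _ _ _ _ Cp Cq.
have C22 := C1_plus _ _ _ _ _ _ (C1_const 1) (C1_pointwise_dot _ _ _ _ _ _ Cq Cq).
have Cg := C1_minus _ _ _ _ _ _ (C1_mult _ _ _ _ _ _ C11 C22) (C1_mult _ _ _ _ _ _ C12 C12).
have CK := C1_sqrt_inv _ _ _ Cg gram_gt0.
have sg x y : 0 < sqrt (g x y) by apply: sqrt_lt_R0; exact: gram_gt0.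
have P0 x y : 0 <= S p p x y by apply: big_Rplus_ge0 => i; have := pow2_ge_0 (p i x y); lra.
have Q0 x y : 0 <= S q q x y by apply: big_Rplus_ge0 => i; have := pow2_ge_0 (q i x y); lra.
have [|||||a [b [d H]]] := unimodular_hessian_const _ _ _ _ _ _ _ _ _
  (C1_mult _ _ _ _ _ _ C11 CK) (C1_mult _ _ _ _ _ _ C12 CK) (C1_mult _ _ _ _ _ _ C22 CK).
- move=> x y; have Mp := minimal_dot p x y; have Mq := minimal_dot q x y.
  have g0 := gram_gt0 x y; have s0 := sg x y.
  rewrite ?(pointwise_dot_sym s p) ?(pointwise_dot_sym r p) !(pointwise_dot_sym s q) !(pointwise_dot_sym r q) !(pointwise_dot_sym t q).
  rewrite -/(g11 x y) -/(g22 x y) -/(g12 x y) -/(g x y).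
  move: s0; set w := sqrt _ => s0; 
  have Eg : g x y = g11 x y * g22 x y - g12 x y * g12 x y by [].
  move: g0 Eg Mp Mq; move: (g x y) (g11 x y) (g12 x y) (g22 x y) => G a b c g0 Eg Mp Mq.
  apply: Rminus_diag_uniq; set lhs := (X in X = 0).
  (* The closedness defect is a combination of the system dotted with [p] and with [q], divided by
     g^(3/2); the second closedness goal has coefficients c and -b instead of b and -a. *)
  have -> : lhs = (b * (S p r x y * c - 2 * S p s x y * b + S p t x y * a)
      - a * (S q r x y * c - 2 * S q s x y * b + S q t x y * a)) / (G * w).
    by rewrite /lhs Eg; rewrite Eg in g0; field; lra.
  by rewrite Mp Mq; field; lra.
- move=> x y; have Mp := minimal_dot p x y; have Mq := minimal_dot q x y.
  have g0 := gram_gt0 x y; have s0 := sg x y.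
  rewrite ?(pointwise_dot_sym s p) ?(pointwise_dot_sym r p) !(pointwise_dot_sym s q) !(pointwise_dot_sym r q) ?(pointwise_dot_sym t q).
  rewrite -/(g11 x y) -/(g22 x y) -/(g12 x y) -/(g x y).
  move: s0; set w := sqrt _ => s0.
  have Eg : g x y = g11 x y * g22 x y - g12 x y * g12 x y by [].
  move: g0 Eg Mp Mq; move: (g x y) (g11 x y) (g12 x y) (g22 x y) => G a b c g0 Eg Mp Mq.
  apply: Rminus_diag_uniq; set lhs := (X in X = 0).
  have -> : lhs = (c * (S p r x y * c - 2 * S p s x y * b + S p t x y * a)
      - b * (S q r x y * c - 2 * S q s x y * b + S q t x y * a)) / (G * w).
    by rewrite /lhs Eg; rewrite Eg in g0; field; lra.
  by rewrite Mp Mq; field; lra.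
- move=> x y; apply: Rmult_lt_0_compat; last by apply: Rinv_0_lt_compat; exact: sg.
  by have := P0 x y; lra.
- move=> x y; apply: Rmult_lt_0_compat; last by apply: Rinv_0_lt_compat; exact: sg.
  by have := Q0 x y; lra.
- move=> x y; have s0 := sg x y.
  rewrite -/(g11 x y) -/(g22 x y) -/(g12 x y) -/(g x y).
  transitivity ((g11 x y * g22 x y - g12 x y * g12 x y) / (sqrt (g x y) * sqrt (g x y))).
    by field; lra.
  rewrite -/(g x y).
  by rewrite sqrt_sqrt; [field|]; have := gram_gt0 x y; lra.
exists a, b, d => x y; have [<- [<- <-]] := H x y; have s0 := sg x y.
rewrite -/(g11 x y) -/(g22 x y) -/(g12 x y) -/(g x y).
by split; [|split]; field; lra.
Qed.

(** Divided by sqrt g, the system has constant coefficients shared by all components, so it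
    decouples into one elliptic equation for each. *)
Lemma minimal_constant_coefficients : exists a b d,
  0 < d /\ a * d - b * b = 1 /\
  forall i x y, d * r i x y - 2 * b * s i x y + a * t i x y = 0.
Proof.
have [a [b [d H]]] := normalized_metric_const.
have sg x y : 0 < sqrt (g x y) by apply: sqrt_lt_R0; exact: gram_gt0.
exists a, b, d; split; [|split].
- have [_ [_ E]] := H 0 0; have := sg 0 0.
  have : 0 < g22 0 0.
    have : 0 <= S q q 0 0.
      by apply: big_Rplus_ge0 => i; have := pow2_ge_0 (q i 0 0); lra.
    by rewrite /g22; lra.
  by rewrite E; nra.
- have Eg : g 0 0 = g11 0 0 * g22 0 0 - g12 0 0 * g12 0 0 by [].
  move: (H 0 0) (sg 0 0) (sqrt_sqrt _ (Rlt_le _ _ (gram_gt0 0 0))).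
  move: (sqrt (g 0 0)) => w [E1 [E2 E3]] w0; rewrite Eg E1 E2 E3 => E.
  apply: (Rmult_eq_reg_r (w * w)); last by nra.
  by rewrite Rmult_1_l {2}E; ring.
- move=> i x y; have [E1 [E2 E3]] := H x y; have S0 := sg x y.
  have := minimal i x y; rewrite E1 E2 E3 => E.
  apply: (Rmult_eq_reg_r _ _ _ _ (Rgt_not_eq _ _ S0)).
  by rewrite Rmult_0_l -E; ring.
Qed.

End MinimalSystem.

Lemma small_growth_linear (f : R -> R -> R) (m l k : R) :
  small_growth 2 f -> small_growth 2 (fun s t => f (m * s) (l * s + k * t)).
Proof.
(* The linear map multiplies squared lengths by at most K, and K r^2 <= (K r)^2 because K >= 1; so
   B_r goes into B_(K r). *)
move=> Hf e e0; pose K := 1 + m ^ 2 + 2 * l ^ 2 + 2 * k ^ 2.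
have m2 := pow2_ge_0 m; have l2 := pow2_ge_0 l; have k2 := pow2_ge_0 k.
have K1 : 1 <= K by rewrite /K; lra.
have e1 : 0 < e / K ^ 2 by apply: Rdiv_lt_0_compat => //; apply: pow_lt; lra.
have [r0 H0] := Hf _ e1.
exists (Rmax r0 0) => r s t hr hd.
have [h1 h2] : r0 < r /\ 0 < r by move: (Rmax_l r0 0) (Rmax_r r0 0); lra.
have -> : e * r ^ 2 = e / K ^ 2 * (K * r) ^ 2 by field; lra.
apply: H0; first by nra.
have s2 := pow2_ge_0 s; have t2 := pow2_ge_0 t; have rp : 0 < r ^ 2 by apply: pow_lt.
apply: (Rle_lt_trans _ (K * (s ^ 2 + t ^ 2))).
  have := pow2_ge_0 (l * s - k * t).
  have : 0 <= m ^ 2 * t ^ 2 by apply: Rmult_le_pos.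
  have : 0 <= l ^ 2 * t ^ 2 by apply: Rmult_le_pos.
  have : 0 <= k ^ 2 * s ^ 2 by apply: Rmult_le_pos.
  by rewrite /K; nra.
have -> : (K * r) ^ 2 = K * (K * r ^ 2) by ring.
apply: Rmult_lt_compat_l; first by lra.
nra.
Qed.

(* The substitution (x, y) = (m s, l s + k t) turns the operator into the Laplacian. *)
Lemma elliptic_liouville (f p q r s t : R -> R -> R) (a b d : R) :
  C1 f p q -> C1 p r s -> C1 q s t -> 0 < d -> a * d - b * b = 1 ->
  (forall x y, d * r x y - 2 * b * s x y + a * t x y = 0) ->
  small_growth 2 f -> affine2 f.
Proof.
move=> Hf Hp Hq d0 Hdet Heq Hg.
have m0 := sqrt_lt_R0 _ d0; have mm := sqrt_sqrt d (Rlt_le _ _ d0).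
set m := sqrt d in m0 mm.
(* Chosen so that m^2 = d, m l = -b and l^2 + k^2 = (b^2 + 1) / d = a. *)
pose l := - b / m; pose k := / m.
have L1 : C1 (fun x y => m * x) (fun _ _ => m) (fun _ _ => 0).
  by apply: C1_ext (C1_linear m 0 0) => *; ring.
have L2 : C1 (fun x y => l * x + k * y) (fun _ _ => l) (fun _ _ => k).
  by apply: C1_ext (C1_linear l k 0) => *; ring.
have HL (h hx hy : R -> R -> R) : C1 h hx hy ->
    C1 (fun x y => h (m * x) (l * x + k * y))
       (fun x y => m * hx (m * x) (l * x + k * y) + l * hy (m * x) (l * x + k * y))
       (fun x y => k * hy (m * x) (l * x + k * y)).
  by move=> Hh; apply: C1_ext (C1_comp _ _ _ _ _ _ _ _ _ Hh L1 L2) => x y //=; ring.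
have Hu := HL _ _ _ Hf.
have Huy := C1_scal k _ _ _ (HL _ _ _ Hq).
have [a1 [b1 [c1 H]]] : exists a b c, forall x y,
    f (m * x) (l * x + k * y) = a * x + b * y + c.
  apply: harmonic_liouville Hu _ Huy _ (small_growth_linear _ m l k Hg).
  - apply: C1_ext (C1_plus _ _ _ _ _ _ (C1_scal m _ _ _ (HL _ _ _ Hp))
      (C1_scal l _ _ _ (HL _ _ _ Hq))) => x y //; ring.
  - move=> x y.
    move: (Heq (m * x) (l * x + k * y)) => <-.
    move: (r _ _) (s _ _) (t _ _) => R S T.
    have <- : m * m * R - 2 * b * S + (b * b + 1) / (m * m) * T = d * R - 2 * b * S + a * T.
      rewrite mm; have -> : b * b + 1 = a * d by lra.
      by field; lra.
    by rewrite /l /k; field; lra.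
exists ((a1 - b1 * l / k) / m), (b1 / k), c1 => x y.
have k0 : 0 < k by apply: Rinv_0_lt_compat.
have := H (x / m) ((y - l * (x / m)) / k).
have -> : m * (x / m) = x by field; lra.
have -> : l * (x / m) + k * ((y - l * (x / m)) / k) = y by field; lra.
by move=> ->; field; lra.
Qed.

Lemma rpower_small_growth (f : R -> R -> R) (Omega omega r1 : R) :
  0 < Omega -> omega < 2 ->
  (forall r x y, r1 < r -> x ^ 2 + y ^ 2 < r ^ 2 -> Rabs (f x y) <= Omega * Rpower r omega) ->
  small_growth 2 f.
Proof.
move=> O0 o2 H e e0.
(* Here r2^(2 - omega) = Omega / e, so Omega r^omega <= e r^2 from r2 on. *)
pose r2 := Rpower (Omega / e) (/ (2 - omega)).
exists (Rmax r1 r2) => r x y hr hd.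
have [h1 h2] : r1 < r /\ r2 < r by move: (Rmax_l r1 r2) (Rmax_r r1 r2); lra.
have r20 : 0 < r2 by apply: exp_pos.
apply: Rle_trans (H r x y h1 hd) _.
have -> : r ^ 2 = Rpower r omega * Rpower r (2 - omega).
  rewrite -Rpower_plus -Rpower_pow; last lra.
  by congr Rpower; rewrite /=; ring.
have P0 : 0 < Rpower r omega by apply: exp_pos.
suff : Omega / e <= Rpower r (2 - omega).
  move/Rle_div_l => /(_ e0) HH; nra.
have -> : Omega / e = Rpower r2 (2 - omega).
  rewrite /r2 Rpower_mult Rinv_l; last lra.
  by rewrite Rpower_1 //; apply: Rdiv_lt_0_compat.
apply: Rle_Rpower_l; lra.
Qed.

(** * Induced metric and normals of a graph *)

Section Graph.

Variable m : nat.
Variable phi : 'I_(m.+3 - 2) -> R -> R -> R.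

(** The dimension is written [m.+3] so that [m.+3 - 2] converts to [m.+1] and the two lifts
    typecheck. *)
Definition normal_index (s : 'I_(m.+3 - 2)) : 'I_m.+3 := lift ord0 (lift ord0 s).

Lemma graph_coord (s : 'I_(m.+3 - 2)) (x y : R) :
  graph phi x y (normal_index s) = phi s x y.
Proof. by rewrite /graph /= valK. Qed.

Lemma pd_graph_coord (s : 'I_(m.+3 - 2)) (j k : nat) (x y : R) :
  pd (graph phi) j k x y (normal_index s) = partial_derive j k (phi s) x y.
Proof.
rewrite /pd /partial_derive; apply: Derive_n_ext => t; apply: Derive_n_ext => u.
exact: graph_coord.
Qed.

Lemma dot_graph (v w : vec m.+3) :
  dot v w = v ord0 * w ord0 + (v (lift ord0 ord0) * w (lift ord0 ord0) +
    \big[Rplus/0]_(s : 'I_(m.+3 - 2))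
      (v (normal_index s) * w (normal_index s))).
Proof. by rewrite /dot !big_ord_recl. Qed.

Lemma pd_graph_01 (x y : R) (X := graph phi) :
  (pd X 1 0 x y ord0 = 1 /\ pd X 1 0 x y (lift ord0 ord0) = 0) /\
  (pd X 0 1 x y ord0 = 0 /\ pd X 0 1 x y (lift ord0 ord0) = 1) /\
  (pd X 2 0 x y ord0 = 0 /\ pd X 2 0 x y (lift ord0 ord0) = 0) /\
  (pd X 1 1 x y ord0 = 0 /\ pd X 1 1 x y (lift ord0 ord0) = 0) /\
  (pd X 0 2 x y ord0 = 0 /\ pd X 0 2 x y (lift ord0 ord0) = 0).
Proof.
rewrite /X /pd /partial_derive /graph /=.
have D0 c z : Derive (fun _ => c) z = 0 by exact: Derive_const.
have D1 z : Derive (fun t => t) z = 1 by exact: Derive_id.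
have DE c g z : (forall u, g u = c) -> Derive g z = 0.
  by move=> H; rewrite (Derive_ext _ (fun=> c)).
by repeat split; first [exact: D1 | exact: D0 | apply: (DE 0) => u; exact: D0
  | apply: (DE 1) => u; exact: D1].
Qed.

Let P (s : 'I_(m.+3 - 2)) := partial_derive 1 0 (phi s).
Let Q (s : 'I_(m.+3 - 2)) := partial_derive 0 1 (phi s).

Lemma h11_graph x y :
  h11 (graph phi) x y = 1 + \big[Rplus/0]_s (P s x y * P s x y).
Proof.
rewrite /h11 dot_graph; have [[-> ->] _] := pd_graph_01 x y.
rewrite Rmult_1_l Rmult_0_l Rplus_0_l; congr (_ + _).
by apply: eq_bigr => s _; rewrite !pd_graph_coord.
Qed.

Lemma h12_graph x y :
  h12 (graph phi) x y = \big[Rplus/0]_s (P s x y * Q s x y).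
Proof.
rewrite /h12 dot_graph; have [[-> ->] [[-> ->] _]] := pd_graph_01 x y.
rewrite Rmult_0_r Rmult_0_l !Rplus_0_l.
by apply: eq_bigr => s _; rewrite !pd_graph_coord.
Qed.

Lemma h22_graph x y :
  h22 (graph phi) x y = 1 + \big[Rplus/0]_s (Q s x y * Q s x y).
Proof.
rewrite /h22 dot_graph; have [_ [[-> ->] _]] := pd_graph_01 x y.
rewrite Rmult_1_l Rmult_0_l Rplus_0_l; congr (_ + _).
by apply: eq_bigr => s _; rewrite !pd_graph_coord.
Qed.

Definition graph_normal (s : 'I_(m.+3 - 2)) (x y : R) : vec m.+3 :=
  let c := sqrt (1 + P s x y ^ 2 + Q s x y ^ 2) in
  fun i => match nat_of_ord i with
           | O => - P s x y / c
           | S O => - Q s x y / c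
           | S (S k) => if k == s then / c else 0
           end.

Lemma dot_graph_normal (s : 'I_(m.+3 - 2)) (x y : R) (v : vec m.+3) :
  dot v (graph_normal s x y) =
    (v (normal_index s) - v ord0 * P s x y - v (lift ord0 ord0) * Q s x y)
      / sqrt (1 + P s x y ^ 2 + Q s x y ^ 2).
Proof.
rewrite dot_graph /graph_normal /=.
have := big_Rplus_delta _ (fun i => v (normal_index i))
  (/ sqrt (1 + P s x y ^ 2 + Q s x y ^ 2)) s => /= ->.
by rewrite /Rdiv; ring.
Qed.

Lemma graph_normal_unit (s : 'I_(m.+3 - 2)) :
  unit_normal_field (graph phi) (graph_normal s).
Proof.
move=> x y.
have c0 : 0 < 1 + P s x y ^ 2 + Q s x y ^ 2.
  by have := pow2_ge_0 (P s x y); have := pow2_ge_0 (Q s x y); lra.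
have s0 := sqrt_lt_R0 _ c0.
have N v := dot_graph_normal s x y v.
have [[X0 X1] [[Y0 Y1] _]] := pd_graph_01 x y.
have DC a b : @dot m.+3 a b = dot b a by apply: eq_bigr => i _; ring.
split; [|split].
- have -> : enorm (graph_normal s x y) = sqrt 1; last exact: sqrt_1.
  rewrite /enorm N; congr sqrt.
  move: s0 (sqrt_sqrt _ (Rlt_le _ _ c0)); set c := sqrt _ => s0 cc.
  have -> : graph_normal s x y (normal_index s) = / c by rewrite /graph_normal /= eqxx.
  have -> : graph_normal s x y ord0 = - P s x y / c by [].
  have -> : graph_normal s x y (lift ord0 ord0) = - Q s x y / c by [].
  transitivity ((1 + P s x y ^ 2 + Q s x y ^ 2) / (c * c)); first by field; lra.
  by rewrite cc; field; lra.
- by rewrite DC N X0 X1 pd_graph_coord -/(P s x y); field; lra.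
- by rewrite DC N Y0 Y1 pd_graph_coord -/(Q s x y); field; lra.
Qed.

(** Second derivatives of the graph vanish in the first two coordinates, so [graph_normal s]
    isolates those of [phi s], divided by its length factor; multiplying the curvature by that
    factor and 2 W^2 leaves the equation. *)
Lemma minimal_graph_system : (forall s, is_C2 (phi s)) -> minimal_surface (graph phi) ->
  forall s x y,
  partial_derive 2 0 (phi s) x y * h22 (graph phi) x y
  - 2 * partial_derive 1 1 (phi s) x y * h12 (graph phi) x y
  + partial_derive 0 2 (phi s) x y * h11 (graph phi) x y = 0.
Proof.
move=> HC HM s x y.
have := HM _ (graph_normal_unit s) x y.
have G0 := gram_gt0 _ P Q x y; rewrite -h11_graph -h12_graph -h22_graph in G0.
have EW : area_W (graph phi) x y ^ 2 =
    h11 (graph phi) x y * h22 (graph phi) x y - h12 (graph phi) x y * h12 (graph phi) x y.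
  rewrite /area_W -Rsqr_pow2 Rsqr_sqrt; first by ring.
  by apply: Rlt_le; apply: Rlt_le_trans G0 _; right; ring.
have c0 : 0 < 1 + P s x y ^ 2 + Q s x y ^ 2.
  by have := pow2_ge_0 (P s x y); have := pow2_ge_0 (Q s x y); lra.
have s0 := sqrt_lt_R0 _ c0.
have [_ [_ [[A0 A1] [[B0 B1] [D0 D1]]]]] := pd_graph_01 x y.
rewrite /mean_curvature EW !dot_graph_normal A0 A1 B0 B1 D0 D1 !pd_graph_coord.
move: s0 G0; set c := sqrt _; set G := _ - _ * _ => s0 G0 H.
move: (f_equal (fun z => z * (2 * G) * c) H); rewrite !Rmult_0_l => <-.
by field; lra.
Qed.

Lemma minimal_graph_affine : (forall s, is_C2 (phi s)) -> minimal_surface (graph phi) ->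
  (forall s, small_growth 2 (phi s)) -> forall s, affine2 (phi s).
Proof.
move=> HC HM Hg s.
have CP i := proj1 (proj2 (is_C2_C1 _ (HC i))).
have CQ i := proj2 (proj2 (is_C2_C1 _ (HC i))).
have HS := minimal_graph_system HC HM.
have [|a [b [d [d0 [ad H]]]]] := minimal_constant_coefficients _ _ _ _ _ _ CP CQ.
  by move=> i x y; have := HS i x y; rewrite h11_graph h12_graph h22_graph.
exact: (elliptic_liouville _ _ _ _ _ _ a b d (proj1 (is_C2_C1 _ (HC s))) (CP s) (CQ s)).
Qed.

Lemma coord_le_enorm (s : 'I_(m.+3 - 2)) (x y : R) :
  Rabs (phi s x y) <= enorm (graph phi x y).
Proof.
rewrite -sqrt_Rsqr_abs; apply: sqrt_le_1_alt.
rewrite dot_graph -(graph_coord s x y).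
have : graph phi x y (normal_index s) ^ 2 <= \big[Rplus/0]_(i < m.+3 - 2)
    (graph phi x y (normal_index i) * graph phi x y (normal_index i)).
  exact: (big_Rplus_sqr_ge _ (fun i => graph phi x y (normal_index i))).
rewrite /Rsqr.
have := pow2_ge_0 (graph phi x y ord0).
have := pow2_ge_0 (graph phi x y (lift ord0 ord0)).
lra.
Qed.

End Graph.

Lemma affine_graph_plane (n : nat) (phi : 'I_(n - 2) -> R -> R -> R) :
  (3 <= n)%N -> (forall s, affine2 (phi s)) -> represents_affine_plane (graph phi).
Proof.
move=> hn H.
have E x y i : graph phi x y i = graph phi 0 0 i
    + x * (graph phi 1 0 i - graph phi 0 0 i) + y * (graph phi 0 1 i - graph phi 0 0 i).
  rewrite /graph; case: (nat_of_ord i) => [|[|k]]; try ring.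
  case: (insub k) => [s|]; last by ring.
  by have [a [b [c Hs]]] := H s; rewrite !Hs; ring.
exists (graph phi 0 0), (fun i => graph phi 1 0 i - graph phi 0 0 i),
  (fun i => graph phi 0 1 i - graph phi 0 0 i); split.
  move=> s t Hst.
  (* Independence is read off from the first two coordinates, where the directions are (1, 0) and
     (0, 1). *)
  have h0 : (0 < n)%N by apply: leq_trans hn.
  have h1 : (1 < n)%N by apply: leq_trans hn.
  by have := Hst (Ordinal h0); have := Hst (Ordinal h1); rewrite /graph /=; lra.
by move=> q; split=> -[s [t Hq]]; exists s, t => i; rewrite Hq ?[LHS]E ?[RHS]E.
Qed.

Theorem mainTheorem2 (n : nat) (hn : (3 <= n)%N)
    (phi : 'I_(n - 2) -> R -> R -> R)
    (phi_C2 : forall s : 'I_(n - 2), is_C2 (phi s))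
    (X_minimal : minimal_surface (graph phi))
    (Omega omega : R) (Omega_gt0 : 0 < Omega) (omega_range : 0 <= omega < 2)
    (growth : exists r0 : R, forall r : R, r0 < r ->
       Rbar_le (C0_norm_disc (graph phi) r) (Finite (Omega * Rpower r omega))) :
  represents_affine_plane (graph phi) /\
  (forall s : 'I_(n - 2), affine2 (phi s)).
Proof.
suff Haff : forall s, affine2 (phi s) by split=> //; apply: affine_graph_plane.
case: n hn phi phi_C2 X_minimal growth => [|[|[|m]]] // hn phi HC HM [r0 Hr].
apply: minimal_graph_affine => // s.
apply: (rpower_small_growth _ Omega omega r0) => //; first by case: omega_range.
move=> r x y hr hd; apply: Rle_trans (coord_le_enorm _ phi s x y) _.
have [ub _] := Lub_Rbar_correct (fun t => exists x y : R,
  x ^ 2 + y ^ 2 < r ^ 2 /\ t = enorm (graph phi x y)).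
have H1 : Rbar_le (enorm (graph phi x y)) (C0_norm_disc (graph phi) r).
  by apply: ub; exists x, y.
exact: (Rbar_le_trans _ _ _ H1 (Hr r hr)).
Qed.
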